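(* Let $d\ge 2$, let $\Theta=(\theta_{k,\ell})$ be a real antisymmetric $d\times d$ matrix, $q_{k,\ell}=e^{i\theta_{k,\ell}}$, and let $\delta\in(0,1)$. Let $U=(U_1,\dots,U_d)$ be a unitary tuple on a separable Hilbert space such that $\|U_iU_j-q_{j,i}U_jU_i\|\le\delta$ for $1\le i,j\le d$. Then there exist unitary $d$-tuples $V_\Theta$ and $U'$ on separable Hilbert spaces such that (i) $V_\Theta$ is $\Theta$-commuting; (ii) $U'\sim\bigoplus_{\lambda\in\Lambda}\lambda U$ for a countable set $\Lambda\subset\mathbb T^d$; (iii) $\mathrm d_{\mathrm{rD}}(U\to V_\Theta)<(d-1)\sqrt\delta$; (iv) $\mathrm d_{\mathrm{rD}}(V_\Theta\to U')<(d-1)\sqrt\delta$.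
   Context: A unitary tuple $V=(V_1,\dots,V_d)$ is $\Theta$-commuting if $V_\ell V_k=e^{i\theta_{k,\ell}}V_kV_\ell$ for all $k,\ell$. For $\lambda\in\mathbb T^d$, $\lambda U=(\lambda_1U_1,\dots,\lambda_dU_d)$. Direct sums of tuples are taken entrywise. For operator $d$-tuples on the same space, $\|A-B\|=\max_i\|A_i-B_i\|$; maps are applied entrywise. $C^*(A)$ is the unital C*-algebra generated by $A_1,\dots,A_d$, and $S_A=\mathrm{span}\{1,A_i,A_i^*\}$ is the operator system generated by $A$. Write $A\sim A'$ if there is a $*$-isomorphism $C^*(A)\to C^*(A')$ with $A_i\mapsto A_i'$ for all $i$. The one-sided relaxed dilation distance is $\mathrm d_{\mathrm{rD}}(A\to B)=\inf\|\pi(A)-\Psi(B)\|$, the infimum over all Hilbert spaces $\mathcal L$, all unital faithful $*$-representations $\pi\colon C^*(A)\to B(\mathcal L)$ and all unital completely positive maps $\Psi\colon S_B\to B(\mathcal L)$. *)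

(* Defs.v *)
From mathcomp Require Import all_boot all_order all_algebra.
From mathcomp Require Import sesquilinear.
From mathcomp Require Import complex.
From mathcomp Require Import all_classical all_reals all_analysis.

Set Implicit Arguments.
Unset Strict Implicit.
Unset Printing Implicit Defensive.

Import Order.TTheory GRing.Theory Num.Theory.
Import numFieldNormedType.Exports.

Local Open Scope classical_set_scope.
Local Open Scope ring_scope.
Local Open Scope complex_scope.

(* A complex Hilbert space: a Banach space over [R[i]] whose norm comes from an
   inner product, linear in the first argument and conjugate-linear in the
   second.  The zero space is allowed. *)
Record hilbert (R : realType) := Hilbert {
  hilbert_sort :> completeNormedModType R[i];
  inner : {dot hilbert_sort for Num.conj};
  hilbert_normE : forall x : hilbert_sort, `|x| ^+ 2 = inner x x }.

Section Operators.
Variable R : realType.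
Implicit Types H K L : hilbert R.

(* The norm of a normed module over [R[i]] takes its values in [R[i]]; this is
   the same norm as an element of [R]. *)
Definition hnorm H (x : H) : R := complex.Re `|x|.

Definition separable H : Prop := exists2 D : set H, countable D & dense D.

(* Operators are plain functions [H -> H], with the pointwise vector space
   structure; the members of B(H) are those satisfying [bounded_op]. *)
Definition opnorm H (T : H -> H) : \bar R :=
  ereal_sup [set (hnorm (T x))%:E | x in [set x | hnorm x <= 1]].

Arguments opnorm {H} T%_R.

Definition bounded_op H (T : H -> H) : Prop :=
  linear T /\ (opnorm T < +oo)%E.

Definition is_adjoint H (T S : H -> H) : Prop :=
  bounded_op S /\ forall x y, inner H (T x) y = inner H x (S y).

(* The default value is never used when [T] is bounded (Riesz). *)
Definition adj H (T : H -> H) : H -> H := xget 0 (is_adjoint T).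

Definition unitary_op H (T : H -> H) : Prop :=
  [/\ bounded_op T, adj T \o T = id & T \o adj T = id].

Definition star_subalgebra H (S : set (H -> H)) : Prop :=
  [/\ S `<=` @bounded_op H,
      forall a X Y, S X -> S Y -> S (a *: X + Y),
      forall X Y, S X -> S Y -> S (X \o Y)
    & forall X, S X -> S (adj X)].

Definition norm_closed H (S : set (H -> H)) : Prop :=
  forall T, bounded_op T ->
    (forall e : R, 0 < e -> exists2 X, S X & (opnorm (T - X) < e%:E)%E) -> S T.

Definition unital_cstar_subalgebra H (S : set (H -> H)) : Prop :=
  [/\ star_subalgebra S, S id & norm_closed S].

Section Tuples.
Variable d : nat.

Definition unitary_tuple H (A : 'I_d -> H -> H) : Prop :=
  forall i, unitary_op (A i).

Definition cstar H (A : 'I_d -> H -> H) : set (H -> H) :=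
  smallest (@unital_cstar_subalgebra H) (range A).

Definition opsys H (A : 'I_d -> H -> H) : set (H -> H) :=
  [set T | exists (c : R[i]) (a b : 'I_d -> R[i]),
     T = c *: id + \sum_i (a i *: A i + b i *: adj (A i))].

(* Maps out of a set of operators are total functions of which only the values
   on that set matter. *)
Definition linear_on H L (D : set (H -> H)) (f : (H -> H) -> (L -> L)) : Prop :=
  (forall X, D X -> bounded_op (f X)) /\
  (forall a X Y, D X -> D Y -> f (a *: X + Y) = a *: f X + f Y).

Definition star_hom H L (D : set (H -> H)) (f : (H -> H) -> (L -> L)) : Prop :=
  [/\ linear_on D f,
      forall X Y, D X -> D Y -> f (X \o Y) = f X \o f Y
    & forall X, D X -> f (adj X) = adj (f X)].

Definition unital_faithful_rep H L (D : set (H -> H))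
    (f : (H -> H) -> (L -> L)) : Prop :=
  [/\ star_hom D f, f id = id & set_inj D f].

(* [T] as an operator on the n-fold direct sum of [H] is positive; [0 <= z] in
   [R[i]] says that [z] is real and nonnegative. *)
Definition positive_opmx H n (T : 'I_n -> 'I_n -> H -> H) : Prop :=
  forall x : 'I_n -> H, 0 <= \sum_i \sum_j inner H (T i j (x j)) (x i).

Definition completely_positive H L (D : set (H -> H))
    (f : (H -> H) -> (L -> L)) : Prop :=
  forall n (T : 'I_n -> 'I_n -> H -> H), (forall i j, D (T i j)) ->
    positive_opmx T -> positive_opmx (fun i j => f (T i j)).

Definition ucp H L (D : set (H -> H)) (f : (H -> H) -> (L -> L)) : Prop :=
  [/\ linear_on D f, f id = id & completely_positive D f].

Definition tuple_dist H (A B : 'I_d -> H -> H) : \bar R :=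
  (\big[maxe/0]_(i < d) opnorm (A i - B i))%E.

(* The infimum is taken in the extended reals: it is [+oo] when there is no
   competitor, that is, when [K] is zero and [H] is not. *)
Definition drD H K (A : 'I_d -> H -> H) (B : 'I_d -> K -> K) : \bar R :=
  ereal_inf [set r | exists (L : hilbert R) (p : (H -> H) -> (L -> L))
                            (f : (K -> K) -> (L -> L)),
    [/\ unital_faithful_rep (cstar A) p, ucp (opsys B) f
      & r = tuple_dist (p \o A) (f \o B)]].

Definition cstar_equiv H K (A : 'I_d -> H -> H) (B : 'I_d -> K -> K) : Prop :=
  exists f : (H -> H) -> (K -> K),
    [/\ star_hom (cstar A) f, set_bij (cstar A) (cstar B) f
      & forall i, f (A i) = B i].

(* [c] identifies [K] with the l2-direct sum of the [H i], that is, with the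
   space of all square-summable families under the norm
   (sum_i |f i|^2)^(1/2); linearity of [c] and the polarization identity then
   determine the inner product. *)
Definition hilbert_sum (I : choiceType) (H : I -> hilbert R) K
    (c : K -> forall i, H i) : Prop :=
  [/\ forall i, linear (fun x => c x i),
      forall x, (\esum_(i in [set: I]) (hnorm (c x i) ^+ 2)%:E
                 = (hnorm x ^+ 2)%:E)%E
    & forall f : forall i, H i,
        (\esum_(i in [set: I]) (hnorm (f i) ^+ 2)%:E < +oo)%E ->
        exists x, forall i, c x i = f i].

Definition is_direct_sum (I : choiceType) (H : I -> hilbert R)
    (A : forall i, 'I_d -> H i -> H i) K (W : 'I_d -> K -> K) : Prop :=
  exists2 c : K -> forall i, H i, hilbert_sum c
    & forall k x i, c (W k x) i = A i k (c x i).

Definition torus : set ('I_d -> R[i]) := [set z | forall k, `|z k| = 1].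

Definition scale_tuple H (z : 'I_d -> R[i]) (A : 'I_d -> H -> H) :
  'I_d -> H -> H := fun k => z k *: A k.

Definition expi (t : R) : R[i] := cos t +i* sin t.

Definition theta_commuting H (Theta : 'M[R]_d) (V : 'I_d -> H -> H) : Prop :=
  forall k l, V l \o V k = expi (Theta k l) *: (V k \o V l).

End Tuples.
End Operators.

Arguments opnorm {R H} T%_R.

(* Main.v *)
(* Let |F| be the size of a box F of exponents m >= 0, and U^m the ordered
   monomial U_1^m_1 ... U_d^m_d, so that U_i U^m is within
   delta (m_1 + ... + m_(i-1)) of a unimodular multiple of U^(m + e_i).  Take for
   V_Theta the Theta-twisted shifts on l^2(Z^d; H), which satisfy the same
   relation exactly.

   (iii) The isometry x |-> |F|^(-1/2) sum_(m in F) e_m (x) (U^m)^* x compresses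
   V_i to an average over F of operators close to U_i; the defect comes from the
   commutators and from the proportion of the m in F with m + e_i outside F.

   (iv) Conversely, spread x over the shifted boxes r + F: the r-th component is
   |F|^(-1/2) sum_(m in F) (phase) U^m x(r + m), with the Z^d-position r + m
   encoded by a character of a finite group (Z/P)^d.  The operator
   (+)_lambda lambda U over the P-th roots of unity moves the position by e_i and
   applies U_i, so its amplification compresses to V_i up to the same error.

   With sides N in all directions but the last and a huge side in the last one,
   N - 1 <= delta^(-1/2) < N, the error is less than (d - 1) sqrt(delta).  Both
   distances are estimated with the identity representation. *)

Require Import Defs.
From HB Require Import structures.
From mathcomp Require Import all_boot all_order all_algebra.
From mathcomp Require Import sesquilinear.
From mathcomp Require Import complex.
From mathcomp Require Import all_classical all_reals all_analysis.
From mathcomp Require Import ring lra.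

Set Implicit Arguments.
Unset Strict Implicit.
Unset Printing Implicit Defensive.

Import Order.TTheory GRing.Theory Num.Theory.
Import numFieldNormedType.Exports.

Local Open Scope classical_set_scope.
Local Open Scope ring_scope.

(** * Sums of real and complex families *)

(** The scale sqrt(delta) balances the two costs of a side N: 1/N for the boundary, and about N
    delta / 2 for each direction that U_i has to cross, a coordinate of the box being (N - 1)/2 on
    average. Moving U_i into place crosses only the directions before i, so the last side enters no
    commutator cost and can be lengthened freely. Every direction then costs less than (d/2)
    sqrt(delta), and d/2 <= d - 1 because d >= 2.

    A single bicharacter [beta] governs all phases. Its antisymmetrization is Theta, which gives the
    relation between the twisted shifts; and beta(m, e_i) is the phase that U_i picks up when it
    passes U^m. The phases in (iv) are chosen so that these two roles match.

    A finite direct sum can record a position only modulo P; taking P larger than every side rules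
    out wrap-around inside the box. The unbounded index r is carried by an amplification, which
    preserves complete positivity, so the set of torus points stays finite. *)

Lemma dot_CauchySchwarz (C : numClosedFieldType) (U : lmodType C)
    (form : {dot U for Num.conj}) (u v : U) :
  `|form u v| ^+ 2 <= form u u * form v v.
Proof.
have [->|v0] := eqVneq v 0; first by
  rewrite [form u 0]linear0r normr0 expr0n [form 0 0]linear0r mulr0.
have vgt0 : 0 < form v v by exact: neq0_dnorm_gt0.
pose a := form u v / form v v.
have : 0 <= form (u - a *: v) (u - a *: v) by exact: dnorm_ge0.
have vr : (form v v)^* = form v v by rewrite geC0_conj// ltW.
rewrite dnormB dnormZ linearZr_LR/=.
have -> : a^* * form u v = `|form u v| ^+ 2 / form v v.
  by rewrite /a rmorphM /= fmorphV /= vr mulrAC normCK [_ * form u v]mulrC.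
have -> : `|a| ^+ 2 * form v v = `|form u v| ^+ 2 / form v v.
  rewrite /a normrM exprMn normfV (ger0_norm (ltW vgt0)).
  by field; rewrite lt0r_neq0.
have -> : (`|form u v| ^+ 2 / form v v)^* = `|form u v| ^+ 2 / form v v.
  by rewrite geC0_conj// mulr_ge0// invr_ge0 ltW.
rewrite opprD addrA addrK subr_ge0 ler_pdivrMr//.
Qed.

Lemma norm_add_ge0 (R : realDomainType) (x : R) : 0 <= `|x| + x.
Proof. by rewrite -lerBlDr sub0r -normrN ler_norm. Qed.

Section RealSums.
Variables (R : realType) (I : choiceType).
Implicit Types f g : I -> R.

Definition nsum f : \bar R := (\esum_(i in [set: I]) (f i)%:E)%E.
Definition summ f : Prop := (nsum (fun i => `|f i|%R) < +oo)%E.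
(* Meaningful only for absolutely summable families, which [summ] expresses. *)
Definition rsum f : R :=
  fine (nsum (fun i => `|f i| + f i)) - fine (nsum (fun i => `|f i|)).

Lemma nsum_ge0 f : (forall i, 0 <= f i) -> (0 <= nsum f)%E.
Proof. by move=> f0; apply: esum_ge0 => i _; rewrite lee_fin. Qed.

Lemma le_nsum f g : (forall i, f i <= g i) -> (nsum f <= nsum g)%E.
Proof. by move=> fg; apply: le_esum => i _; rewrite lee_fin. Qed.

Lemma nsumD f g : (forall i, 0 <= f i) -> (forall i, 0 <= g i) ->
  nsum (fun i => f i + g i) = (nsum f + nsum g)%E.
Proof. by move=> f0 g0; rewrite -esumD// => i _; rewrite lee_fin. Qed.

Lemma nsumZ a f : 0 <= a -> (forall i, 0 <= f i) ->
  nsum (fun i => a * f i) = (a%:E * nsum f)%E.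
Proof.
move=> a0 f0.
have le b g : 0 <= b -> (forall i, 0 <= g i) ->
    (nsum (fun i => b * g i)%R <= b%:E * nsum g)%E.
  move=> b0 g0; apply: ge_ereal_sup => _ [X [finX XI] <-].
  rewrite (_ : (\sum_(i \in X) (b * g i)%:E)%E
             = (b%:E * \sum_(i \in X) (g i)%:E)%E).
    by apply: lee_wpmul2l; rewrite ?lee_fin//; apply: ereal_sup_ubound; exists X.
  by rewrite ge0_mule_fsumr// => i; rewrite lee_fin.
apply/eqP; rewrite eq_le le//=.
have [->|an0] := eqVneq a 0.
  by rewrite mul0e nsum_ge0// => i; rewrite mul0r.
have ap : 0 < a by rewrite lt_def an0.
(* The reverse inequality is [le] again, for the inverse scalar and the scaled family. *)
have := le a^-1 (fun i => a * f i).
rewrite invr_ge0 => /(_ a0) H.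
have {H} := H (fun i => mulr_ge0 a0 (f0 i)).
rewrite (_ : (fun i => a^-1 * (a * f i)) = f); last first.
  by apply/funext => i; rewrite mulKf.
by rewrite lee_pdivlMl.
Qed.

Lemma nsum_single k f : (forall i, i <> k -> f i = 0) -> 0 <= f k ->
  nsum f = (f k)%:E.
Proof.
move=> f0 fk; rewrite /nsum -(@esum_set1 R I k (fun i => (f i)%:E)) ?lee_fin//.
rewrite [RHS]esum_mkcond; apply: eq_esum => i _.
by have [/set_mem ->//|/negP ik] := boolP (i \in [set k]);
  rewrite f0// => ki; apply: ik; rewrite inE.
Qed.

Lemma nsum_ge (X : seq I) f : uniq X -> (forall i, 0 <= f i) ->
  ((\sum_(i <- X) f i)%:E <= nsum f)%E.
Proof.
move=> uX f0; apply: esum_ge; exists [set` X].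
  by split => //; exact: finite_seq.
by rewrite -fsbig_seq// sumEFin.
Qed.

Lemma summ_le f g : (forall i, `|f i| <= `|g i|) -> summ g -> summ f.
Proof. by move=> fg; apply: le_lt_trans; apply: le_nsum. Qed.

Lemma summ_ge0 f : (forall i, 0 <= f i) -> (nsum f < +oo)%E -> summ f.
Proof.
move=> f0 fs; rewrite /summ (_ : (fun i => `|f i|) = f)//.
by apply/funext => i; rewrite ger0_norm.
Qed.

Lemma summD f g : summ f -> summ g -> summ (fun i => f i + g i).
Proof.
move=> fs gs; apply: (@le_lt_trans _ _ (nsum (fun i => `|f i| + `|g i|))).
  by apply: le_nsum => i; exact: ler_normD.
by rewrite nsumD// lte_add_pinfty.
Qed.

Lemma summZ a f : summ f -> summ (fun i => a * f i).
Proof.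
move=> fs; rewrite /summ (_ : (fun i => _) = (fun i => `|a| * `|f i|)).
  by rewrite nsumZ// lte_mul_pinfty// nsum_ge0.
by apply/funext => i; rewrite normrM.
Qed.

Lemma summN f : summ f -> summ (fun i => - f i).
Proof. by apply: summ_le => i; rewrite normrN. Qed.

Lemma nsum_fin_num f : (forall i, 0 <= f i) -> (nsum f < +oo)%E ->
  nsum f \is a fin_num.
Proof. by move=> f0 fs; rewrite ge0_fin_numE// nsum_ge0. Qed.

(** Makes [rsum] independent of the splitting into a difference of nonnegative summable families;
    its linearity follows by choosing convenient splittings. Two splittings agree after the negative
    parts change sides, where [nsum] is additive. *)
Lemma rsumB f g : (forall i, 0 <= f i) -> (forall i, 0 <= g i) ->
  (nsum f < +oo)%E -> (nsum g < +oo)%E ->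
  rsum (fun i => f i - g i) = fine (nsum f) - fine (nsum g).
Proof.
move=> f0 g0 fs gs; rewrite /rsum.
set a := fun i => `|f i - g i| + (f i - g i); set b := fun i => `|f i - g i|.
have bs : summ (fun i => f i - g i).
  by apply: summD; [exact: summ_ge0|apply: summN; exact: summ_ge0].
have a0 i : 0 <= a i by exact: norm_add_ge0.
have as_ : (nsum a < +oo)%E.
  suff : summ a by rewrite /summ (_ : (fun i => `|a i|) = a)//;
    apply/funext => i; rewrite ger0_norm.
  apply: summD => //; apply: summ_le bs => i; by rewrite normr_id.
have : nsum (fun i => a i + g i) = nsum (fun i => b i + f i).
  by congr nsum; apply/funext => i; rewrite /a /b; ring.
have b0 i : 0 <= b i by exact: normr_ge0.
have {}bs : (nsum b < +oo)%E by exact: bs.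
clearbody a b; rewrite !nsumD//.
move=> /(congr1 fine); rewrite !fineD ?nsum_fin_num// => H.
by apply/eqP; rewrite subr_eq addrAC -subr_eq opprK H addrC.
Qed.

Lemma rsum_ge0E f : (forall i, 0 <= f i) -> summ f -> rsum f = fine (nsum f).
Proof.
move=> f0 fs.
have n0 : nsum (fun=> 0) = 0%E by rewrite /nsum esum1.
have {}fs : (nsum f < +oo)%E.
  by move: fs; rewrite /summ (_ : (fun i => `|f i|) = f)//; apply/funext => i; rewrite ger0_norm.
have := @rsumB f (fun=> 0) f0 (fun=> lexx 0) fs.
rewrite n0 => /(_ (ltry 0)); rewrite subr0 => <-.
by congr rsum; apply/funext => i; rewrite subr0.
Qed.

Lemma rsum_ge0 f : (forall i, 0 <= f i) -> summ f -> 0 <= rsum f.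
Proof. by move=> f0 fs; rewrite rsum_ge0E// fine_ge0// nsum_ge0. Qed.

Lemma summP f : summ f -> exists a b, [/\ forall i, 0 <= a i, forall i, 0 <= b i,
  (nsum a < +oo)%E, (nsum b < +oo)%E & f = fun i => a i - b i].
Proof.
move=> fs; exists (fun i => `|f i| + f i), (fun i => `|f i|); split => //.
- by move=> i; exact: norm_add_ge0.
- apply: (@le_lt_trans _ _ (nsum (fun i => 2 * `|f i|))).
    by apply: le_nsum => i; rewrite mulr2n mulrDl mul1r lerD2l ler_norm.
  by rewrite nsumZ// lte_mul_pinfty// nsum_ge0.
- by apply/funext => i; rewrite addrAC subrr add0r.
Qed.

Lemma rsumD f g : summ f -> summ g ->
  rsum (fun i => f i + g i) = rsum f + rsum g.
Proof.
move=> /summP[a [b [a0 b0 as_ bs ->]]] /summP[a' [b' [a'0 b'0 as' bs' ->]]].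
rewrite (_ : (fun i => _) = (fun i => (a i + a' i) - (b i + b' i))).
  rewrite !rsumB ?nsumD ?lte_add_pinfty//; try by move=> i; rewrite addr_ge0.
  by rewrite !fineD ?nsum_fin_num//; ring.
by apply/funext => i; ring.
Qed.

Lemma rsumN f : summ f -> rsum (fun i => - f i) = - rsum f.
Proof.
move=> /summP[a [b [a0 b0 as_ bs ->]]].
rewrite (_ : (fun i => _) = (fun i => b i - a i)); first by rewrite !rsumB// opprB.
by apply/funext => i; rewrite opprB.
Qed.

Lemma rsumZ c f : summ f -> rsum (fun i => c * f i) = c * rsum f.
Proof.
have pos d g : 0 <= d -> summ g -> rsum (fun i => d * g i) = d * rsum g.
  move=> d0 /summP[a [b [a0 b0 as_ bs ->]]].
  rewrite (_ : (fun i => _) = (fun i => d * a i - d * b i)).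
    rewrite !rsumB//; try by move=> i; rewrite mulr_ge0.
    + by rewrite !nsumZ// !fineM ?nsum_fin_num// mulrBr.
    + by rewrite nsumZ// lte_mul_pinfty// nsum_ge0.
    + by rewrite nsumZ// lte_mul_pinfty// nsum_ge0.
  by apply/funext => i; rewrite mulrBr.
move=> fs; have [c0|/ltW c0] := leP 0 c; first exact: pos.
have := @pos (- c) f; rewrite oppr_ge0 => /(_ c0 fs) H.
rewrite -[c]opprK mulNr -H -rsumN.
  by congr rsum; apply/funext => i; rewrite !mulNr opprK.
exact: summZ.
Qed.

Lemma rsum0 : rsum (fun=> 0) = 0.
Proof. by rewrite /rsum normr0 addr0 subrr. Qed.

Lemma summ_single k f : (forall i, i <> k -> f i = 0) -> summ f.
Proof.
move=> f0; rewrite /summ (@nsum_single k) ?ltry// => i ik.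
by rewrite f0// normr0.
Qed.

Lemma rsum_single k f : (forall i, i <> k -> f i = 0) -> rsum f = f k.
Proof.
move=> f0; rewrite /rsum !(@nsum_single k).
- by rewrite /= addrAC subrr add0r.
- by move=> i ik; rewrite f0// normr0.
- exact: normr_ge0.
- by move=> i ik; rewrite f0// normr0 addr0.
- exact: norm_add_ge0.
Qed.

End RealSums.

Section RealSumsReindex.
Variables (R : realType) (I J : choiceType) (s : I -> J) (t : J -> I).
Hypotheses (st : cancel s t) (ts : cancel t s).

Lemma nsum_reindex (f : J -> R) : (forall j, 0 <= f j) ->
  nsum (fun i => f (s i)) = nsum f.
Proof.
move=> f0; rewrite /nsum (@reindex_esum R I J [set: I] [set: J] s)//.
split => //; first by move=> x y _ _; exact: (can_inj st).
by move=> y _; exists (t y).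
Qed.

Lemma rsum_reindex (f : J -> R) : rsum (fun i => f (s i)) = rsum f.
Proof.
rewrite /rsum (@nsum_reindex (fun j => `|f j|))//.
rewrite (@nsum_reindex (fun j => `|f j| + f j))// => j.
exact: norm_add_ge0.
Qed.
End RealSumsReindex.

Section ComplexSums.
Local Open Scope complex_scope.
Variables (R : realType) (I : choiceType).
Implicit Types f g : I -> R[i].

Definition csumm f := summ (fun i => complex.Re (f i)) /\ summ (fun i => complex.Im (f i)).
Definition csum f : R[i] :=
  rsum (fun i => complex.Re (f i)) +i* rsum (fun i => complex.Im (f i)).

Lemma csumm_le f (g : I -> R) : (forall i, `|f i| <= (g i)%:C) -> summ g -> csumm f.
Proof.
move=> fg gs; split; apply: summ_le gs => i.
  rewrite -lecR; apply: le_trans (normc_ge_Re _) _.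
  by apply: le_trans (fg i) _; rewrite lecR ler_norm.
(* Up to sign, the imaginary part is the real part after multiplication by the unimodular ['i]. *)
have := normc_ge_Re (f i * 'i); rewrite ReiNIm normrN => H.
rewrite -lecR; apply: le_trans H _; rewrite normrM (_ : `|'i| = 1 :> R[i]) ?mulr1.
  by apply: le_trans (fg i) _; rewrite lecR ler_norm.
by rewrite complexiE normCi.
Qed.

Lemma csummD f g : csumm f -> csumm g -> csumm (fun i => f i + g i).
Proof.
move=> [f1 f2] [g1 g2]; split.
  rewrite (_ : (fun i => _) = (fun i => complex.Re (f i) + complex.Re (g i))); first exact: summD.
  by apply/funext => i; case: (f i); case: (g i).
rewrite (_ : (fun i => _) = (fun i => complex.Im (f i) + complex.Im (g i))); first exact: summD.
by apply/funext => i; case: (f i); case: (g i).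
Qed.

Lemma csummZ a f : csumm f -> csumm (fun i => a * f i).
Proof.
case: a => a b [f1 f2]; split.
  rewrite (_ : (fun i => _) = (fun i => a * complex.Re (f i) + (- b) * complex.Im (f i))).
    by apply: summD; apply: summZ.
  by apply/funext => i; case: (f i) => x y /=; rewrite mulNr.
rewrite (_ : (fun i => _) = (fun i => a * complex.Im (f i) + b * complex.Re (f i))).
  by apply: summD; apply: summZ.
by apply/funext => i; case: (f i) => x y /=.
Qed.

Lemma csumD f g : csumm f -> csumm g ->
  csum (fun i => f i + g i) = csum f + csum g.
Proof.
move=> [f1 f2] [g1 g2]; rewrite /csum; apply/eqP; rewrite eq_complex/=.
rewrite -!rsumD//; apply/andP; split; apply/eqP; congr rsum; apply/funext => i;
  by case: (f i); case: (g i).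
Qed.

Lemma csumZ a f : csumm f -> csum (fun i => a * f i) = a * csum f.
Proof.
case: a => a b [f1 f2]; rewrite /csum; apply/eqP; rewrite eq_complex/=.
rewrite -mulNr -!rsumZ// -!rsumD; try exact: summZ.
apply/andP; split; apply/eqP; congr rsum; apply/funext => i;
  by case: (f i) => x y/=; rewrite ?mulNr.
Qed.

Lemma csum_conj f : csumm f -> csum (fun i => (f i)^*) = (csum f)^*.
Proof.
move=> [f1 f2]; rewrite /csum; apply/eqP; rewrite eq_complex/= -rsumN//.
by apply/andP; split; apply/eqP; congr rsum; apply/funext => i; case: (f i).
Qed.

Lemma csum_sum (K : Type) (s : seq K) (F : K -> I -> R[i]) :
  (forall k, csumm (F k)) ->
  csumm (fun i => \sum_(k <- s) F k i) /\
  csum (fun i => \sum_(k <- s) F k i) = \sum_(k <- s) csum (F k).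
Proof.
move=> Fs; elim: s => [|k s [IH1 IH2]].
  rewrite big_nil (_ : (fun i => _) = (fun=> 0)).
    have z : summ (fun i : I => 0 : R) by rewrite /summ /nsum esum1// => i _; rewrite normr0.
    split; first by split.
    by rewrite /csum /= rsum0.
  by apply/funext => i; rewrite big_nil.
rewrite big_cons (_ : (fun i => _) = (fun i => F k i + \sum_(j <- s) F j i)).
  by rewrite csumD// IH2; split => //; exact: csummD.
by apply/funext => i; rewrite big_cons.
Qed.

Lemma csum_ge0 f : (forall i, 0 <= f i) -> csumm f -> 0 <= csum f.
Proof.
move=> f0 [f1 f2]; rewrite lecE /=.
have -> : (fun i => complex.Im (f i)) = fun=> 0.
  by apply/funext => i; apply: ger0_Im.
apply/andP; split.
  by rewrite /rsum normr0 addr0 subrr.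
by apply: rsum_ge0 => // i; have := f0 i; rewrite lecE => /andP[].
Qed.

Lemma csum_real (f : I -> R) : csum (fun i => (f i)%:C) = (rsum f)%:C.
Proof. by rewrite /csum /= /rsum normr0 addr0 subrr. Qed.

Lemma csum_single k f : (forall i, i <> k -> f i = 0) -> csum f = f k.
Proof.
move=> f0; rewrite /csum !(@rsum_single _ _ k); first by case: (f k).
  by move=> i ik; rewrite f0.
by move=> i ik; rewrite f0.
Qed.

Lemma csumm_single k f : (forall i, i <> k -> f i = 0) -> csumm f.
Proof. by move=> f0; split; apply: (@summ_single _ _ k) => i ik; rewrite f0. Qed.

End ComplexSums.

Lemma csum_reindex (R : realType) (I J : choiceType) (s : I -> J) (t : J -> I)
    (f : J -> R[i]%C) : cancel s t -> cancel t s ->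
  csum (fun i => f (s i)) = csum f.
Proof.
move=> st ts; rewrite /csum.
by rewrite (rsum_reindex st ts (fun j => complex.Re (f j)))
  (rsum_reindex st ts (fun j => complex.Im (f j))).
Qed.

Lemma csum_fin (R : realType) (T : finType) (f : T -> R[i]%C) :
  csum f = \sum_i f i.
Proof.
pose F k i := if i == k then f k else 0 : R[i]%C.
have Fs k : csumm (F k).
  by apply: (@csumm_single _ _ k) => i /eqP ik; rewrite /F (negbTE ik).
have := (csum_sum (index_enum T) Fs).2.
rewrite (_ : (fun i => _) = f) => [->|]; last first.
  apply/funext => i; rewrite (bigD1 i)//= {1}/F eqxx big1 ?addr0// => k ki.
  by rewrite /F eq_sym (negbTE ki).
apply: eq_bigr => k _; rewrite (@csum_single _ _ k) /F ?eqxx// => i /eqP ik.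
by rewrite (negbTE ik).
Qed.

(** * Square-summable families *)

Section HilbertNorm.
Local Open Scope complex_scope.
Variables (R : realType) (H : hilbert R).
Implicit Types (x y : H) (a : R[i]).

Lemma normhE x : `|x| = (hnorm x)%:C.
Proof. by rewrite /hnorm RRe_real// ger0_real. Qed.

Lemma hnorm_ge0 x : 0 <= hnorm x.
Proof. by rewrite -ler0c -normhE. Qed.

Lemma hnorm_triangle x y : hnorm (x + y) <= hnorm x + hnorm y.
Proof. by rewrite -lecR rmorphD /= -!normhE ler_normD. Qed.

Lemma hnormZ a x : hnorm (a *: x) = complex.Re `|a| * hnorm x.
Proof.
apply: complexI; rewrite rmorphM /= -!normhE normrZ.
by congr (_ * _); rewrite RRe_real// ger0_real.
Qed.

Lemma hnormN x : hnorm (- x) = hnorm x.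
Proof. by rewrite /hnorm normrN. Qed.

Lemma hnorm0 : hnorm (0 : H) = 0.
Proof. by rewrite /hnorm normr0. Qed.

Lemma hnorm_sqr x : (hnorm x ^+ 2)%:C = inner H x x.
Proof. by rewrite rmorphXn /= -normhE hilbert_normE. Qed.

Lemma inner_le x y : `|inner H x y| <= (hnorm x * hnorm y)%:C.
Proof.
have n0 : (0 : R[i]) <= (hnorm x * hnorm y)%:C.
  by rewrite ler0c mulr_ge0// hnorm_ge0.
rewrite -ler_sqr ?nnegrE//.
have <- : inner H x x * inner H y y = (hnorm x * hnorm y)%:C ^+ 2.
  by rewrite rmorphM exprMn -!rmorphXn /= !hnorm_sqr.
exact: dot_CauchySchwarz.
Qed.

Lemma inner_le_sqr x y : `|inner H x y| <= (hnorm x ^+ 2 + hnorm y ^+ 2)%:C.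
Proof.
apply: le_trans (inner_le x y) _; rewrite lecR.
by have := hnorm_ge0 x; have := hnorm_ge0 y; nra.
Qed.

Lemma hnormD_sqr_le x y :
  hnorm (x + y) ^+ 2 <= 2 * (hnorm x ^+ 2 + hnorm y ^+ 2).
Proof.
apply: (@le_trans _ _ ((hnorm x + hnorm y) ^+ 2)).
  by rewrite ler_sqr ?nnegrE ?addr_ge0 ?hnorm_ge0// hnorm_triangle.
by have := sqr_ge0 (hnorm x - hnorm y); nra.
Qed.

Lemma inner_conj x y : inner H x y = (inner H y x)^*.
Proof. by rewrite (hermitian_subproof x y) /= expr0 mul1r. Qed.

Lemma innerZr a x y : inner H x (a *: y) = a^* * inner H x y.
Proof. exact: linearZr_LR. Qed.

Lemma innerZl a x y : inner H (a *: x) y = a * inner H x y.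
Proof. exact: linearZl_LR. Qed.

Lemma innerDl x y z : inner H (y + z) x = inner H y x + inner H z x.
Proof. exact: linearDl. Qed.

Lemma inner0l x : inner H 0 x = 0.
Proof. exact: linear0l. Qed.

Lemma inner_sumr (T : Type) (s : seq T) (P : pred T) (F : T -> H) x :
  inner H x (\sum_(i <- s | P i) F i) = \sum_(i <- s | P i) inner H x (F i).
Proof. exact: raddf_sum. Qed.

Lemma inner_suml (T : Type) (s : seq T) (P : pred T) (F : T -> H) x :
  inner H (\sum_(i <- s | P i) F i) x = \sum_(i <- s | P i) inner H (F i) x.
Proof.
elim/big_ind2 : _ => [|a b c e <- <-|//]; first exact: inner0l.
exact: innerDl.
Qed.

Lemma inner_eq0 x : (forall y, inner H x y = 0) -> x = 0.
Proof.
by move=> x0; apply/eqP; rewrite -(dnorm_eq0 (inner H)) x0.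
Qed.

Lemma inner_ext x y : (forall z, inner H x z = inner H y z) -> x = y.
Proof.
move=> xy; apply/eqP; rewrite -subr_eq0; apply/eqP; apply: inner_eq0 => z.
by rewrite [LHS]linearBl /= xy subrr.
Qed.

Lemma hnorm_eq0 x : hnorm x = 0 -> x = 0.
Proof. by move=> x0; apply/normr0_eq0; rewrite normhE x0. Qed.

Lemma hnorm_sum (T : Type) (s : seq T) (P : pred T) (F : T -> H) :
  hnorm (\sum_(i <- s | P i) F i) <= \sum_(i <- s | P i) hnorm (F i).
Proof.
elim/big_rec2 : _ => [|i a b _ le]; first by rewrite hnorm0.
by apply: le_trans (hnorm_triangle _ _) _; rewrite lerD2l.
Qed.

End HilbertNorm.

Section SquareSummable.
Local Open Scope complex_scope.
Variables (R : realType) (I : choiceType) (H : hilbert R).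

(** A boolean predicate, so that the square-summable families inherit their vector space structure
    as a submodule of [I -> H]. *)
Definition sqr_summable : {pred I -> H} :=
  fun f => `[< summ (fun i => hnorm (f i) ^+ 2) >].

Record l2_type := L2 { l2_fun :> I -> H; _ : sqr_summable l2_fun }.

HB.instance Definition _ := [isSub for l2_fun].
HB.instance Definition _ := [Choice of l2_type by <:].

Lemma sqr_summable_submod : submod_closed sqr_summable.
Proof.
split => [|a f g].
  apply/asboolP; rewrite /summ /nsum esum1// => i _.
  by rewrite hnorm0 expr0n normr0.
move=> /asboolP fs /asboolP gs; apply/asboolP.
apply: (@summ_le _ _ _
  (fun i => 2 * ((complex.Re `|a|) ^+ 2 * hnorm (f i) ^+ 2 + hnorm (g i) ^+ 2))).
  move=> i; rewrite ger0_norm ?sqr_ge0// ger0_norm; last first.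
    by rewrite mulr_ge0// addr_ge0 ?sqr_ge0// mulr_ge0 ?sqr_ge0.
  by rewrite -exprMn -hnormZ; exact: hnormD_sqr_le.
by apply: summZ; apply: summD => //; apply: summZ.
Qed.

HB.instance Definition _ :=
  GRing.isSubmodClosed.Build R[i] (I -> H) sqr_summable sqr_summable_submod.
HB.instance Definition _ := [SubChoice_isSubLmodule of l2_type by <:].

Lemma l2D (x y : l2_type) i : (x + y) i = x i + y i.
Proof. by []. Qed.

Lemma l2N (x : l2_type) i : (- x) i = - x i.
Proof. by []. Qed.

Lemma l2_ext (x y : l2_type) : (forall i, x i = y i) -> x = y.
Proof. by move=> xy; apply/val_inj/funext. Qed.

Lemma l2_summ (x : l2_type) : summ (fun i => hnorm (x i) ^+ 2).
Proof. by case: x => f /= fs; apply/asboolP. Qed.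

Lemma l2_sum (T : Type) (s : seq T) (P : pred T) (F : T -> l2_type) i :
  (\sum_(k <- s | P k) F k) i = \sum_(k <- s | P k) F k i.
Proof. by elim/big_ind2 : _ => // a b c e <- <-. Qed.

Definition l2_inner (x y : l2_type) : R[i] := csum (fun i => inner H (x i) (y i)).

Lemma l2_csumm (x y : l2_type) : csumm (fun i => inner H (x i) (y i)).
Proof.
apply: (csumm_le (fun i => inner_le_sqr (x i) (y i))).
exact: summD (l2_summ x) (l2_summ y).
Qed.

Lemma l2_inner_linearl y : GRing.linear_for *%R (l2_inner^~ y).
Proof.
move=> a x z; rewrite /l2_inner -csumZ; last exact: l2_csumm.
rewrite -csumD; last exact: l2_csumm.
  by congr csum; apply/funext => i; rewrite innerDl innerZl.
by apply: csummZ; exact: l2_csumm.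
Qed.

Lemma l2_inner_hermitian x y : l2_inner x y = (-1) ^+ false * (l2_inner y x)^*.
Proof.
rewrite expr0 mul1r /l2_inner -[RHS]/((csum _)^*%C) -csum_conj; last exact: l2_csumm.
by congr csum; apply/funext => i; rewrite inner_conj.
Qed.

Lemma l2_inner_linearr x : GRing.linear_for (Num.conj \; *%R) (l2_inner x).
Proof.
move=> a y z; rewrite l2_inner_hermitian expr0 mul1r l2_inner_linearl.
by rewrite rmorphD rmorphM /= [l2_inner x y]l2_inner_hermitian
  [l2_inner x z]l2_inner_hermitian !expr0 !mul1r.
Qed.

Lemma l2_innerxx x : l2_inner x x = (rsum (fun i => hnorm (x i) ^+ 2))%:C.
Proof.
by rewrite -csum_real; congr csum; apply/funext => i; rewrite hnorm_sqr.
Qed.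

Lemma l2_coord_le (x : l2_type) i :
  hnorm (x i) ^+ 2 <= rsum (fun i => hnorm (x i) ^+ 2).
Proof.
rewrite rsum_ge0E; [|by move=> j; exact: sqr_ge0|exact: l2_summ].
have := @nsum_ge R I [:: i] (fun i => hnorm (x i) ^+ 2) erefl.
rewrite big_seq1 => /(_ (fun j => sqr_ge0 _)); rewrite -lee_fin fineK//.
apply: nsum_fin_num => [j|]; first exact: sqr_ge0.
apply: le_lt_trans (l2_summ x); apply: le_nsum => j; exact: ler_norm.
Qed.

Lemma l2_inner_gt0 x : x != 0 -> 0 < l2_inner x x.
Proof.
move=> x0; rewrite l2_innerxx ltcE /= eqxx /= lt_def.
have r0 : 0 <= rsum (fun i => hnorm (x i) ^+ 2).
  by apply: rsum_ge0 (l2_summ x) => j; exact: sqr_ge0.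
rewrite r0 andbT; apply: contra x0 => /eqP s0; apply/eqP/l2_ext => i.
apply: hnorm_eq0; apply/eqP; rewrite -sqrf_eq0 eq_le sqr_ge0 andbT -s0.
exact: l2_coord_le.
Qed.

HB.instance Definition _ := bilinear_isBilinear.Build R[i] l2_type l2_type R[i]
  *%R (Num.conj \; *%R) l2_inner (l2_inner_linearl, l2_inner_linearr).
HB.instance Definition _ := isHermitianSesquilinear.Build R[i] l2_type false
  Num.conj l2_inner l2_inner_hermitian.
HB.instance Definition _ := isDotProduct.Build R[i] l2_type l2_inner l2_inner_gt0.

Definition l2_norm (x : l2_type) : R[i] :=
  (Num.sqrt (rsum (fun i => hnorm (x i) ^+ 2)))%:C.

Lemma l2_norm_sqr x : l2_norm x ^+ 2 = l2_inner x x.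
Proof.
rewrite l2_innerxx -rmorphXn /= sqr_sqrtr//.
by apply: rsum_ge0 (l2_summ x) => j; exact: sqr_ge0.
Qed.

Lemma l2_norm_ge0 x : 0 <= l2_norm x.
Proof. by rewrite ler0c sqrtr_ge0. Qed.

Lemma l2_normD x y : l2_norm (x + y) <= l2_norm x + l2_norm y.
Proof.
rewrite -ler_sqr ?nnegrE ?addr_ge0 ?l2_norm_ge0// sqrrD !l2_norm_sqr.
rewrite (dnormD l2_inner) [leRHS]addrAC lerD2l.
have cs : `|l2_inner x y| <= l2_norm x * l2_norm y.
  rewrite -ler_sqr ?nnegrE ?mulr_ge0 ?l2_norm_ge0// exprMn !l2_norm_sqr.
  exact: dot_CauchySchwarz.
have nr := le_trans (normc_ge_Re (l2_inner x y)) cs.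
rewrite -[X in X <= _]/(l2_inner x y + (l2_inner x y)^*) addcJ mulr_natl lerMn2r/=.
by apply: le_trans nr; rewrite lecR ler_norm.
Qed.

Lemma l2_normZ a x : l2_norm (a *: x) = `|a| * l2_norm x.
Proof.
apply/eqP; rewrite -(@eqrXn2 _ 2)// ?mulr_ge0 ?l2_norm_ge0//.
by rewrite exprMn !l2_norm_sqr (dnormZ l2_inner).
Qed.

Lemma l2_norm_eq0 x : l2_norm x = 0 -> x = 0.
Proof.
move=> x0; apply/eqP; rewrite -(dnorm_eq0 l2_inner).
by rewrite -[X in X == _]/(l2_inner x x) -l2_norm_sqr x0 expr0n.
Qed.

HB.instance Definition _ := Lmodule_isNormed.Build R[i] l2_type
  l2_normD l2_normZ l2_norm_eq0.


Lemma l2_norm_le (x : l2_type) (e : R) : 0 <= e ->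
  (nsum (fun i => hnorm (x i) ^+ 2)%R <= (e ^+ 2)%:E)%E -> (`|x| <= e%:C)%R.
Proof.
move=> e0 le; rewrite -[`|x|]/(l2_norm x) lecR -(@ler_sqr _ (Num.sqrt _)) ?nnegrE ?sqrtr_ge0//.
have x0 i : 0 <= hnorm (x i) ^+ 2 by exact: sqr_ge0.
rewrite sqr_sqrtr; last by apply: rsum_ge0 (l2_summ x).
rewrite rsum_ge0E//; last exact: l2_summ.
by rewrite -lee_fin fineK// nsum_fin_num//; apply: le_lt_trans le (ltry _).
Qed.

Lemma l2_coord_norm (x : l2_type) i : `|x i| <= `|x|.
Proof.
rewrite -[`|x|]/(l2_norm x) normhE lecR -(@ler_sqr _ (hnorm _)) ?nnegrE ?hnorm_ge0 ?sqrtr_ge0//.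
rewrite sqr_sqrtr; last by apply: rsum_ge0 (l2_summ x) => j; exact: sqr_ge0.
exact: l2_coord_le.
Qed.

Lemma hnorm_cvg (T : Type) (F : set_system T) (f : T -> H) (l : H) :
  Filter F -> f @ F --> l -> hnorm (f t) @[t --> F] --> hnorm l.
Proof.
move=> FF fl; apply/cvgrPdist_le => e e0.
have ec : 0 < e%:C by rewrite ltcR.
move/cvgrPdist_le : fl => /(_ _ ec); apply: filterS => t.
rewrite normhE lecR; apply: le_trans.
have h1 := hnorm_triangle (l - f t) (f t); have h2 := hnorm_triangle (f t - l) l.
rewrite subrK in h1; rewrite subrK -(hnormN (f t - l)) opprB in h2.
by rewrite ler_norml; apply/andP; split; lra.
Qed.

Lemma l2_cauchy_small (F : set_system l2_type) : ProperFilter F -> cauchy F ->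
  forall e : R, 0 < e ->
    exists2 A, F A & forall u v, A u -> A v -> `|u - v| <= e%:C.
Proof.
move=> FF /cauchy_ballP Fc e e0.
have ec : 0 < e%:C by rewrite ltcR.
have [[P Q] [/= FP FQ] PQ] := Fc _ ec.
exists (P `&` Q); first exact: filterI.
move=> u v [Pu _] [_ Qv]; apply: ltW.
by have := PQ (u, v) (conj Pu Qv); rewrite -ball_normE.
Qed.

Lemma nsum_le (f : I -> R) (b : \bar R) :
  (forall s : seq I, uniq s -> ((\sum_(i <- s) f i)%:E <= b)%E) -> (nsum f <= b)%E.
Proof.
move=> le; apply: ge_ereal_sup => _ [X [finX _] <-].
by rewrite fsbig_finite//= sumEFin le.
Qed.

(** Coordinates are dominated by the norm, hence converge to some family [z]; the uniform estimate
    [near] shows both that [z] is square-summable and that the filter converges to it in norm. *)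
Lemma l2_complete (F : set_system l2_type) : ProperFilter F -> cauchy F -> cvg F.
Proof.
move=> FF Fc; have small := l2_cauchy_small FF Fc.
pose z i : H := lim ((fun x : l2_type => x i) @ F).
have zl i : (fun x : l2_type => x i) @ F --> z i.
  apply: cauchy_cvg; apply/cauchy_ballP => e e0.
  have [e' e'0 ->] : exists2 e' : R, 0 < e' & e = e'%:C.
    exists (complex.Re e); first by move: e0; rewrite ltcE => /andP[].
    by rewrite RRe_real// gtr0_real.
  have e2 : 0 < e' / 2 by rewrite divr_gt0.
  have [A FA Ae] := small _ e2.
  exists ([set x i | x in A], [set x i | x in A]) => /=.
    have FA' : F [set x | [set x i | x in A] (x i)].
      by apply: filterS FA => x Ax; exists x.
    by split.
  move=> [_ _] /= [[u Au <-] [v Av <-]]; rewrite -ball_normE /=.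
  apply: (@le_lt_trans _ _ (e' / 2)%:C).
    by apply: le_trans (Ae _ _ Au Av); exact: (l2_coord_norm (u - v)).
  by rewrite ltcR ltr_pdivrMr// ltr_pMr// ltr1n.
(* A Fatou argument: for fixed [u] the bound on a finite partial sum survives the coordinatewise
   limit in [v], and [nsum] is the supremum of such partial sums. *)
have near (A : set l2_type) e : F A -> 0 <= e ->
    (forall u v, A u -> A v -> `|u - v| <= e%:C) -> forall u, A u ->
    (nsum (fun i => hnorm (u i - z i) ^+ 2)%R <= (e ^+ 2)%:E)%E.
  move=> FA e0 Ae u Au; apply: nsum_le => s us; rewrite lee_fin.
  have cv : (fun v : l2_type => \sum_(i <- s) hnorm (u i - v i) ^+ 2) @ F -->
      \sum_(i <- s) hnorm (u i - z i) ^+ 2.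
    elim: {us} s => [|i s IH].
      by under eq_fun do rewrite big_nil; rewrite big_nil; exact: cvg_cst.
    under eq_fun do rewrite big_cons; rewrite big_cons; apply: cvgD => //.
    have h : hnorm (u i - v i) @[v --> F] --> hnorm (u i - z i).
      by apply: hnorm_cvg; apply: cvgB; [exact: cvg_cst|exact: zl].
    by under eq_fun do rewrite expr2; rewrite expr2; apply: cvgM.
  apply: (cvgr_to_le cv); apply: filterS FA => v Av.
  have := Ae _ _ Au Av; rewrite -[`|_|]/(l2_norm _) lecR => le.
  have n0 i : 0 <= hnorm ((u - v) i) ^+ 2 by exact: sqr_ge0.
  have : (nsum (fun i => hnorm ((u - v) i) ^+ 2)%R <= (e ^+ 2)%:E)%E.
    rewrite -[nsum _]fineK; last first.
      apply: nsum_fin_num => //; apply: le_lt_trans (l2_summ (u - v)).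
      by apply: le_nsum => i; exact: ler_norm.
    rewrite lee_fin -rsum_ge0E//; last exact: l2_summ.
    rewrite -[leLHS]sqr_sqrtr; last by apply: rsum_ge0 (l2_summ (u - v)).
    by rewrite ler_sqr ?nnegrE ?sqrtr_ge0.
  by rewrite -lee_fin; apply: le_trans; exact: nsum_ge.
have [A FA Ae] := small 1 ltr01.
have [u Au] := filter_ex FA.
have wP : sqr_summable (fun i => u i - z i).
  apply/asboolP; apply: summ_ge0 => [i|]; first exact: sqr_ge0.
  by apply: le_lt_trans (near _ _ FA ler01 Ae _ Au) (ltry _).
(* The family [z] as a member of the space: only its difference from [u] is known to be
   square-summable so far. *)
pose y := u - L2 wP.
have yz i : y i = z i by rewrite /y /= opprB addrC subrK.
apply: (cvgP y); apply/cvgrPdist_le => e e0.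
have [e' e'0 ->] : exists2 e' : R, 0 < e' & e = e'%:C.
  exists (complex.Re e); first by move: e0; rewrite ltcE => /andP[].
  by rewrite RRe_real// gtr0_real.
have [B FB Be] := small _ e'0.
have FB' := FB; apply: filterS FB' => t Bt; rewrite distrC; apply: l2_norm_le (ltW e'0) _.
have := near _ _ FB (ltW e'0) Be _ Bt; apply: le_trans.
by apply: le_nsum => i; rewrite l2D l2N yz.
Qed.

HB.instance Definition _ := Uniform_isComplete.Build l2_type l2_complete.

End SquareSummable.

Section L2.
Local Open Scope complex_scope.
Variables (R : realType) (I : choiceType) (H : hilbert R).

Definition l2 : hilbert R := @Hilbert R (l2_type I H) (@l2_inner R I H) (@l2_norm_sqr R I H).
Implicit Types x y : l2.

Lemma hnorm_l2 x : hnorm x ^+ 2 = rsum (fun i => hnorm (l2_fun x i) ^+ 2).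
Proof.
rewrite /hnorm -[`|x|]/(l2_norm x) /= sqr_sqrtr//.
by apply: rsum_ge0 (l2_summ x) => j; exact: sqr_ge0.
Qed.

Lemma hnorm_l2E x :
  (hnorm x ^+ 2)%:E = nsum (fun i => hnorm (l2_fun x i) ^+ 2).
Proof.
have x0 i : 0 <= hnorm (l2_fun x i) ^+ 2 by exact: sqr_ge0.
rewrite hnorm_l2 rsum_ge0E//; last exact: l2_summ.
rewrite fineK//; apply: nsum_fin_num => //; apply: le_lt_trans (l2_summ x).
by apply: le_nsum => i; exact: ler_norm.
Qed.

Lemma inner_l2 x y : inner l2 x y = csum (fun i => inner H (l2_fun x i) (l2_fun y i)).
Proof. by []. Qed.

(** Total, with value 0 off the square-summable families, so that an operator can be given by a
    formula before it is shown to be bounded. *)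
Definition mkl2 (f : I -> H) : l2 := insubd (0 : l2_type I H) f.

Lemma mkl2E (f : I -> H) i : sqr_summable f -> l2_fun (mkl2 f) i = f i.
Proof. by move=> fP; rewrite /mkl2 /insubd insubT. Qed.

Lemma sqr_summable_nsum (f : I -> H) :
  (nsum (fun i => hnorm (f i) ^+ 2)%R < +oo)%E -> sqr_summable f.
Proof. by move=> fs; apply/asboolP; apply: summ_ge0 => // i; exact: sqr_ge0. Qed.

End L2.

(** * Bounded operators and the relaxed dilation distance *)

Section Operators.
Local Open Scope complex_scope.
Variable R : realType.
Implicit Types H K L : hilbert R.

(** Unlike [bounded_op], this covers maps between two spaces, such as the isometries of the
    dilations, and it provides a real bound. *)
Definition bop H L (T : H -> L) : Prop :=
  linear T /\ exists2 C : R, 0 <= C & forall x, hnorm (T x) <= C * hnorm x.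

(** A relation, so that adjoints are exhibited by explicit formulas, also between different spaces;
    [adjE] links it to [adj]. *)
Definition adjp H L (T : H -> L) (S : L -> H) : Prop :=
  forall x y, inner L (T x) y = inner H x (S y).

Section LinearFacts.
Variables (H L : hilbert R) (T : H -> L).
Hypothesis Tl : linear T.

Lemma lin0 : T 0 = 0.
Proof. by have := Tl (-1) 0 0; rewrite scaler0 addr0 scaleN1r addNr. Qed.

Lemma linD x y : T (x + y) = T x + T y.
Proof. by have := Tl 1 x y; rewrite !scale1r. Qed.

Lemma linZ a x : T (a *: x) = a *: T x.
Proof. by have := Tl a x 0; rewrite !addr0 lin0 addr0. Qed.

Lemma lin_sum (I : Type) (s : seq I) (P : pred I) (F : I -> H) :
  T (\sum_(i <- s | P i) F i) = \sum_(i <- s | P i) T (F i).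
Proof.
elim/big_rec2 : _ => [|i a b _ <-]; first exact: lin0.
by rewrite linD.
Qed.

Lemma linB x y : T (x - y) = T x - T y.
Proof. by rewrite linD -scaleN1r linZ scaleN1r. Qed.
End LinearFacts.

Lemma opnorm_le H (T : H -> H) (C : R) : 0 <= C ->
  (forall x, hnorm (T x) <= C * hnorm x) -> (opnorm T <= C%:E)%E.
Proof.
move=> C0 le; apply: ge_ereal_sup => _ [x /= x1 <-]; rewrite lee_fin.
by apply: le_trans (le x) _; rewrite ler_piMr.
Qed.

Lemma opnorm_le_inv H (T : H -> H) (C : R) : linear T -> (opnorm T <= C%:E)%E ->
  forall x, hnorm (T x) <= C * hnorm x.
Proof.
move=> Tl le x; have [x0|x0] := eqVneq (hnorm x) 0.
  by rewrite (hnorm_eq0 x0) (lin0 Tl) !hnorm0 mulr0.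
have xp : 0 < hnorm x by rewrite lt_def x0 hnorm_ge0.
have nE : complex.Re `|(hnorm x)^-1%:C| = (hnorm x)^-1.
  by rewrite ger0_norm// ler0c invr_ge0 hnorm_ge0.
have : ((hnorm (T ((hnorm x)^-1%:C *: x)))%:E <= C%:E)%E.
  apply: le_trans le; apply: ereal_sup_ubound.
  by exists ((hnorm x)^-1%:C *: x) => //=; rewrite hnormZ nE mulVf.
by rewrite lee_fin (linZ Tl) hnormZ nE mulrC ler_pdivrMr.
Qed.

Lemma bounded_opP H (T : H -> H) : bounded_op T <-> bop T.
Proof.
split=> [[Tl Tb]|[Tl [C C0 le]]]; split => //.
  have [r rT] : exists r : R, (opnorm T <= r%:E)%E.
    case: (opnorm T) Tb => [r| |]//; first by exists r.
    by exists 0; rewrite leNye.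
  exists (Num.max r 0); first by rewrite le_max lexx orbT.
  move=> x; apply: le_trans (opnorm_le_inv Tl rT x) _.
  by rewrite ler_wpM2r ?hnorm_ge0// le_max lexx.
exact: le_lt_trans (opnorm_le C0 le) (ltry _).
Qed.

Lemma bop_id H : bop (@id H).
Proof. by split => //; exists 1 => // x; rewrite mul1r. Qed.

Lemma bop0 H L : bop (fun _ : H => 0 : L).
Proof.
split=> [a x y|]; first by rewrite scaler0 addr0.
by exists 0 => // x; rewrite hnorm0 mul0r.
Qed.

Lemma bop_comp H K L (S : K -> L) (T : H -> K) : bop S -> bop T -> bop (S \o T).
Proof.
move=> [Sl [C C0 Sb]] [Tl [D D0 Tb]]; split.
  by move=> a x y; rewrite /= Tl Sl.
exists (C * D); first exact: mulr_ge0.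
move=> x /=; apply: le_trans (Sb _) _.
by rewrite -mulrA ler_wpM2l.
Qed.

Lemma bop_lin H L (a : R[i]) (S T : H -> L) : bop S -> bop T -> bop (a *: S + T).
Proof.
move=> [Sl [C C0 Sb]] [Tl [D D0 Tb]]; split.
  move=> b x y; rewrite -[LHS]/(a *: S (b *: x + y) + T (b *: x + y)).
  rewrite -[RHS]/(b *: (a *: S x + T x) + (a *: S y + T y)) Sl Tl.
  by rewrite !scalerDr !scalerA [a * b]mulrC !addrA; congr (_ + _);
    rewrite -!addrA; congr (_ + _); rewrite addrC.
exists (complex.Re `|a| * C + D).
  by rewrite addr_ge0// mulr_ge0// -ler0c RRe_real ?ger0_real.
move=> x; rewrite -[(_ + _) x]/(a *: S x + T x).
apply: le_trans (@hnorm_triangle _ L (a *: S x) (T x)) _; rewrite mulrDl hnormZ lerD//.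
by rewrite -mulrA ler_wpM2l// -ler0c RRe_real ?ger0_real.
Qed.

Lemma bopD H L (S T : H -> L) : bop S -> bop T -> bop (S + T).
Proof. by move=> bS bT; rewrite -[S]scale1r; exact: bop_lin. Qed.

Lemma bopZ H L a (S : H -> L) : bop S -> bop (a *: S).
Proof. by move=> bS; rewrite -[_ *: _]addr0; apply: bop_lin (bop0 H L). Qed.

Lemma bop_sum H L (I : Type) (s : seq I) (P : pred I) (F : I -> H -> L) :
  (forall i, bop (F i)) -> bop (\sum_(i <- s | P i) F i).
Proof.
move=> bF; elim/big_rec : _ => [|i S _ bS]; first exact: bop0.
exact: bopD.
Qed.

Lemma fun_sumE (T : Type) (L : lmodType R[i]) (I : Type) (s : seq I) (P : pred I)
    (F : I -> T -> L) x :
  (\sum_(i <- s | P i) F i) x = \sum_(i <- s | P i) F i x.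
Proof. by elim/big_rec2 : _ => // i a b _ <-. Qed.

Lemma adjp_sym H L (T : H -> L) S : adjp T S -> adjp S T.
Proof. by move=> a x y; rewrite inner_conj -a -inner_conj. Qed.

Lemma adjp_lin H L (T : H -> L) S : linear T -> adjp S T -> linear S.
Proof.
move=> Tl TS a x y; apply: inner_ext => z.
by rewrite TS !innerDl !innerZl !TS.
Qed.

Lemma adjE H (T S : H -> H) : bop S -> adjp T S -> adj T = S.
Proof.
move=> /bounded_opP bS TS; apply: xget_unique; first by split.
move=> S' [_ TS']; apply/funext => y; apply: inner_ext => z.
by rewrite !(inner_conj _ z) -TS' -TS.
Qed.

(** True of any function [T]: [adj T] is either a bounded adjoint by its specification or the
    default value 0. *)
Lemma bop_adj H (T : H -> H) : bop (adj T).
Proof.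
apply/bounded_opP; rewrite /adj; case: xgetP => [S -> [bS _]//|_].
by apply/bounded_opP; exact: bop0.
Qed.

(** If [T] had no adjoint, [adj T] would be the default 0, and [adj T \o T = id] would make the
    space zero, where the identity is trivial. *)
Lemma unitary_adjp H (T : H -> H) : unitary_op T -> adjp T (adj T).
Proof.
move=> [_ T1 _]; move: T1; rewrite /adj; case: xgetP => [S -> [_ TS]//|_ T1].
have z (x : H) : x = 0 by rewrite -[x]/(id x) -T1.
by move=> x y; rewrite (z x) (z (T _)) !inner0l.
Qed.

Lemma unitary_bop H (T : H -> H) : unitary_op T -> bop T.
Proof. by move=> [/bounded_opP]. Qed.

Lemma unitary_adjK H (T : H -> H) : unitary_op T -> cancel T (adj T).
Proof. by move=> [_ e _] x; rewrite -[LHS]/((adj T \o T) x) e. Qed.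

Lemma unitary_Kadj H (T : H -> H) : unitary_op T -> cancel (adj T) T.
Proof. by move=> [_ _ e] x; rewrite -[LHS]/((T \o adj T) x) e. Qed.

Lemma adjp_hnorm H L (T : H -> L) (S : L -> H) x : adjp T S -> S (T x) = x ->
  hnorm (T x) = hnorm x.
Proof.
move=> TS STx; apply/eqP; rewrite -(@eqrXn2 _ 2)// ?hnorm_ge0//; apply/eqP.
by apply: complexI; rewrite !hnorm_sqr TS STx.
Qed.

Lemma unitary_hnorm H (T : H -> H) x : unitary_op T -> hnorm (T x) = hnorm x.
Proof.
by move=> uT; apply: (adjp_hnorm (unitary_adjp uT)); exact: unitary_adjK.
Qed.

Lemma unitary_adj_hnorm H (T : H -> H) x : unitary_op T ->
  hnorm (adj T x) = hnorm x.
Proof. by move=> uT; rewrite -(unitary_hnorm (adj T x) uT) unitary_Kadj. Qed.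

Lemma unitaryI H (T S : H -> H) : bop T -> bop S -> adjp T S ->
  cancel T S -> cancel S T -> unitary_op T.
Proof.
move=> bT bS TS T1 T2; rewrite /unitary_op (adjE bS TS).
by split; [exact/bounded_opP|exact/funext|exact/funext].
Qed.

Lemma unitary_id H : unitary_op (@id H).
Proof. by apply: (@unitaryI _ _ id) => //; exact: bop_id. Qed.

Lemma unitary_comp H (S T : H -> H) : unitary_op S -> unitary_op T ->
  unitary_op (S \o T).
Proof.
move=> uS uT; apply: (@unitaryI _ _ (adj T \o adj S)).
- by apply: bop_comp; exact: unitary_bop.
- by apply: bop_comp; exact: bop_adj.
- by move=> x y /=; rewrite (unitary_adjp uS) (unitary_adjp uT).
- by move=> x /=; rewrite !unitary_adjK.
- by move=> x /=; rewrite !unitary_Kadj.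
Qed.

Lemma unitary_iter H (T : H -> H) n : unitary_op T -> unitary_op (iter n T).
Proof.
move=> uT; elim: n => [|n IH]; first exact: unitary_id.
exact: (unitary_comp uT IH).
Qed.

Lemma unitary_scale H (T : H -> H) (c : R[i]) : `|c| = 1 -> unitary_op T ->
  unitary_op (c *: T).
Proof.
move=> c1 uT.
have cc : c^*%R * c = 1 by rewrite mulrC -normCK c1 expr1n.
apply: (@unitaryI _ _ (c^*%R *: adj T)).
- by apply: bopZ; exact: unitary_bop.
- by apply: bopZ; exact: bop_adj.
- move=> x y; rewrite -[(c *: T) x]/(c *: T x) -[(_ *: adj T) y]/(c^*%R *: adj T y).
  by rewrite innerZl innerZr conjCK (unitary_adjp uT).
- move=> x; rewrite -[(_ *: adj T) _]/(c^*%R *: adj T (c *: T x)).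
  by rewrite (linZ (bop_adj T).1) scalerA cc scale1r unitary_adjK.
- move=> x; rewrite -[(c *: T) _]/(c *: T (c^*%R *: adj T x)).
  by rewrite (linZ (unitary_bop uT).1) scalerA mulrC cc scale1r unitary_Kadj.
Qed.

Lemma bounded_ops_cstar H : unital_cstar_subalgebra (@bounded_op R H).
Proof.
split; last by move=> T.
- split=> //.
  + by move=> a X Y /bounded_opP bX /bounded_opP bY; apply/bounded_opP; exact: bop_lin.
  + by move=> X Y /bounded_opP bX /bounded_opP bY; apply/bounded_opP; exact: bop_comp.
  + by move=> X _; apply/bounded_opP; exact: bop_adj.
- by apply/bounded_opP; exact: bop_id.
Qed.

Section Tuples.
Variable d : nat.

Lemma cstar_bounded H (A : 'I_d -> H -> H) : unitary_tuple A ->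
  cstar A `<=` @bounded_op R H.
Proof.
move=> uA T; apply; split; first exact: bounded_ops_cstar.
by move=> _ [i _ <-]; apply/bounded_opP/unitary_bop.
Qed.

Lemma opsys_bop H (A : 'I_d -> H -> H) T : unitary_tuple A -> opsys A T -> bop T.
Proof.
move=> uA [c [a [b ->]]]; apply: bopD; first by apply: bopZ; exact: bop_id.
apply: bop_sum => i; apply: bopD; apply: bopZ; first exact: unitary_bop.
exact: bop_adj.
Qed.

Lemma id_faithful_rep H (A : 'I_d -> H -> H) : unitary_tuple A ->
  unital_faithful_rep (cstar A) (@id (H -> H)).
Proof.
by move=> uA; split => //; split => //; split => // X; exact: cstar_bounded.
Qed.

Lemma drD_le H K (A : 'I_d -> H -> H) (B : 'I_d -> K -> K) f (C : R) :
  unitary_tuple A -> ucp (opsys B) f -> 0 <= C ->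
  (forall i x, hnorm (A i x - f (B i) x) <= C * hnorm x) ->
  (drD A B <= C%:E)%E.
Proof.
move=> uA fB C0 le.
apply: (@le_trans _ _ (tuple_dist (id \o A) (f \o B))).
  by apply: ereal_inf_lbound; exists H, id, f; split => //; exact: id_faithful_rep.
rewrite /tuple_dist; elim/big_rec : _ => [|i x _ xC]; first by rewrite lee_fin.
by rewrite ge_max xC andbT; apply: opnorm_le => // y; exact: le.
Qed.

Lemma cstar_equiv_refl H (A : 'I_d -> H -> H) : unitary_tuple A ->
  cstar_equiv A A.
Proof.
move=> uA; exists id; split => //; first by case: (id_faithful_rep uA).
by split => //= x Ax; exists x.
Qed.

(** Complete positivity: moving [W'] to the other side of the inner product turns the compressed
    form at [x] into the form of [T] at [W \o x]. Unitality is [W' \o W = id]. *)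
Lemma compress_ucp H K (B : 'I_d -> K -> K) (W : H -> K) (W' : K -> H) :
  unitary_tuple B -> bop W -> bop W' -> adjp W W' -> cancel W W' ->
  ucp (opsys B) (fun T => W' \o T \o W).
Proof.
move=> uB bW bW' WW' WK; split.
- split=> [X /(opsys_bop uB) bX|a X Y _ _].
    by apply/bounded_opP; apply: bop_comp => //; exact: bop_comp.
  by apply/funext => x; rewrite /= -[RHS]/(a *: W' (X (W x)) + W' (Y (W x))) -bW'.1.
- exact/funext.
- move=> n T _ pT x; have := pT (W \o x); congr (0 <= _).
  apply: eq_bigr => i _; apply: eq_bigr => j _ /=.
  by rewrite (adjp_sym WW').
Qed.

End Tuples.
End Operators.

(** * Operators on square-summable families *)

Section WeightedComposition.
Local Open Scope complex_scope.
Variables (R : realType) (I J : choiceType) (H G : hilbert R).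
Variables (s : I -> J) (t : J -> I) (C : R).
Hypotheses (st : cancel s t) (ts : cancel t s) (C0 : 0 <= C).

(* Twisted shifts, direct sums and amplifications are all of this form. *)
Definition wcomp (B : I -> H -> G) (x : l2 J H) : l2 I G :=
  mkl2 (fun i => B i (l2_fun x (s i))).

Section Bounded.
Variable B : I -> H -> G.
Hypothesis Bb : forall i h, hnorm (B i h) <= C * hnorm h.

Lemma wcomp_nsum (x : l2 J H) :
  (nsum (fun i => hnorm (B i (l2_fun x (s i))) ^+ 2)%R
   <= ((C * hnorm x) ^+ 2)%:E)%E.
Proof.
apply: (@le_trans _ _ (nsum (fun i => C ^+ 2 * hnorm (l2_fun x (s i)) ^+ 2)%R)).
  apply: le_nsum => i; rewrite -exprMn ler_sqr ?nnegrE ?hnorm_ge0//.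
  by rewrite mulr_ge0 ?hnorm_ge0.
rewrite nsumZ ?sqr_ge0// => [|i]; last exact: sqr_ge0.
rewrite (nsum_reindex st ts (f := fun j => hnorm (l2_fun x j) ^+ 2)).
  by rewrite -hnorm_l2E -EFinM -exprMn.
by move=> j; exact: sqr_ge0.
Qed.

Lemma wcompE (x : l2 J H) i : l2_fun (wcomp B x) i = B i (l2_fun x (s i)).
Proof.
apply: (mkl2E i); apply: sqr_summable_nsum.
exact: le_lt_trans (wcomp_nsum x) (ltry _).
Qed.

Lemma wcomp_le (x : l2 J H) : hnorm (wcomp B x) <= C * hnorm x.
Proof.
rewrite -ler_sqr ?nnegrE ?mulr_ge0 ?hnorm_ge0// -lee_fin hnorm_l2E.
apply: le_trans (wcomp_nsum x); apply: le_nsum => i.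
by rewrite wcompE.
Qed.

Lemma wcomp_bop : (forall i, linear (B i)) -> bop (wcomp B).
Proof.
move=> Bl; split; last by exists C => // x; exact: wcomp_le.
move=> a x y; apply: l2_ext => i; rewrite wcompE.
rewrite -[RHS]/(a *: l2_fun (wcomp B x) i + l2_fun (wcomp B y) i) !wcompE.
exact: Bl.
Qed.
End Bounded.
End WeightedComposition.

Section WcompAdjoint.
Local Open Scope complex_scope.
Variables (R : realType) (I J : choiceType) (H G : hilbert R).
Variables (s : I -> J) (t : J -> I) (C : R).
Hypotheses (st : cancel s t) (ts : cancel t s) (C0 : 0 <= C).

Lemma wcomp_adj (B : I -> H -> G) (B' : I -> G -> H) :
  (forall i h, hnorm (B i h) <= C * hnorm h) ->
  (forall i g, hnorm (B' i g) <= C * hnorm g) ->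
  (forall i, adjp (B i) (B' i)) ->
  adjp (wcomp s B) (wcomp t (fun j => B' (t j))).
Proof.
move=> Bb B'b BB x y; rewrite !inner_l2.
rewrite -(csum_reindex _ st ts); congr csum; apply/funext => i.
by rewrite (wcompE st ts C0)// (wcompE ts st C0) ?st ?BB// => j g.
Qed.

End WcompAdjoint.

Lemma wcomp_unitary (R : realType) (I : choiceType) (H : hilbert R)
    (s t : I -> I) (C : R) (B B' : I -> H -> H) :
  cancel s t -> cancel t s -> 0 <= C ->
  (forall i, linear (B i)) -> (forall i, linear (B' i)) ->
  (forall i h, hnorm (B i h) <= C * hnorm h) ->
  (forall i g, hnorm (B' i g) <= C * hnorm g) ->
  (forall i, adjp (B i) (B' i)) ->
  (forall i, cancel (B i) (B' i)) -> (forall i, cancel (B' i) (B i)) ->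
  unitary_op (wcomp s B).
Proof.
move=> st ts C0 Bl B'l Bb B'b BB BK KB.
have B'b' j g : hnorm (B' (t j) g) <= C * hnorm g by exact: B'b.
apply: (@unitaryI _ _ _ (wcomp t (fun j => B' (t j)))).
- exact: (wcomp_bop st ts C0).
- exact: (wcomp_bop ts st C0).
- exact: (wcomp_adj st ts C0).
- move=> x; apply: l2_ext => i.
  by rewrite (wcompE ts st C0)// (wcompE st ts C0)// BK ts.
- move=> x; apply: l2_ext => i.
  by rewrite (wcompE st ts C0)// (wcompE ts st C0)// st KB.
Qed.

Section Amplification.
Local Open Scope complex_scope.
Variables (R : realType) (I : choiceType) (G : hilbert R).

Definition amp (T : G -> G) : l2 I G -> l2 I G := wcomp id (fun=> T).

Lemma ampE T x i : bop T -> l2_fun (amp T x) i = T (l2_fun x i).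
Proof.
move=> [_ [C C0 Tb]].
by rewrite (@wcompE _ _ _ _ _ id id _ (fun=> erefl) (fun=> erefl) C0).
Qed.

Lemma amp_bop T : bop T -> bop (amp T).
Proof.
move=> [Tl [C C0 Tb]].
exact: (@wcomp_bop _ _ _ _ _ id id _ (fun=> erefl) (fun=> erefl) C0).
Qed.

(** The form of the amplified matrix is the sum over the coordinates [r] of the original form
    evaluated at the [r]-th coordinates, each of which is nonnegative. *)
Lemma amp_pos n (T : 'I_n -> 'I_n -> G -> G) : (forall i j, bop (T i j)) ->
  positive_opmx T -> positive_opmx (fun i j => amp (T i j)).
Proof.
move=> bT pT x.
have sm i j : csumm (fun r => inner G (T i j (l2_fun (x j) r)) (l2_fun (x i) r)).
  have := l2_csumm (amp (T i j) (x j)) (x i).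
  by congr csumm; apply/funext => r; rewrite -/(l2_fun _ _) ampE.
have sm2 i := @csum_sum _ _ _ (index_enum 'I_n) _ (sm i).
have [h3 h4] := @csum_sum _ _ _ (index_enum 'I_n) _ (fun i => (sm2 i).1).
rewrite (_ : \sum_i _ = csum (fun r => \sum_i \sum_j
    inner G (T i j (l2_fun (x j) r)) (l2_fun (x i) r))).
  by apply: csum_ge0 => // r; exact: pT.
rewrite h4; apply: eq_bigr => i _; rewrite (sm2 i).2; apply: eq_bigr => j _.
by rewrite inner_l2; congr csum; apply/funext => r; rewrite ampE.
Qed.

(** Linearity is claimed on the operator system only: for an unbounded function, [amp] may fall back
    on the default value of [mkl2]. *)
Lemma compress_amp_ucp d (H : hilbert R) (B : 'I_d -> G -> G)
    (W : H -> l2 I G) (W' : l2 I G -> H) :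
  unitary_tuple B -> bop W -> bop W' -> adjp W W' -> cancel W W' ->
  ucp (opsys B) (fun T => W' \o amp T \o W).
Proof.
move=> uB bW bW' WW' WK; split.
- split=> [X /(opsys_bop uB) bX|a X Y /(opsys_bop uB) bX /(opsys_bop uB) bY].
    by apply/bounded_opP; apply: bop_comp => //; apply: bop_comp => //; exact: amp_bop.
  apply/funext => x; rewrite /=.
  rewrite -[RHS]/(a *: W' (amp X (W x)) + W' (amp Y (W x))) -bW'.1; congr W'.
  apply: l2_ext => i; rewrite ampE; last exact: bop_lin.
  by rewrite -[RHS]/(a *: l2_fun (amp X (W x)) i + l2_fun (amp Y (W x)) i) !ampE.
- apply/funext => x /=; rewrite (_ : amp id (W x) = W x) ?WK//.
  by apply: l2_ext => i; rewrite ampE//; exact: bop_id.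
- move=> n T DT pT x; have := @amp_pos _ T (fun i j => opsys_bop uB (DT i j)) pT (W \o x).
  congr (0 <= _); apply: eq_bigr => i _; apply: eq_bigr => j _ /=.
  by rewrite (adjp_sym WW').
Qed.
End Amplification.

(** * Finitely supported vectors and separability *)

Section PointMass.
Local Open Scope complex_scope.
Variables (R : realType) (I : choiceType) (H : hilbert R).

Definition l2_pt (n : I) (h : H) : l2 I H := mkl2 (fun i => if i == n then h else 0).

Lemma l2_ptE n h i : l2_fun (l2_pt n h) i = if i == n then h else 0.
Proof.
apply: (mkl2E i); apply: sqr_summable_nsum; rewrite (@nsum_single _ _ n).
- exact: ltry.
- by move=> j /eqP /negbTE ->; rewrite hnorm0 expr0n.
- exact: sqr_ge0.
Qed.

Lemma inner_pt n h (y : l2 I H) : inner (l2 I H) (l2_pt n h) y = inner H h (l2_fun y n).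
Proof.
rewrite inner_l2 (@csum_single _ _ n); first by rewrite l2_ptE eqxx.
by move=> i /eqP /negbTE e; rewrite l2_ptE e inner0l.
Qed.

Lemma hnorm_pt n h : hnorm (l2_pt n h) = hnorm h.
Proof.
apply/eqP; rewrite -(@eqrXn2 _ 2)// ?hnorm_ge0//; apply/eqP.
by apply: complexI; rewrite !hnorm_sqr inner_pt l2_ptE eqxx.
Qed.

Lemma l2_pt_bop n : bop (l2_pt n).
Proof.
split; last by exists 1 => // h; rewrite hnorm_pt mul1r.
move=> a x y; apply: l2_ext => i.
rewrite -[RHS]/(a *: l2_fun (l2_pt n x) i + l2_fun (l2_pt n y) i) !l2_ptE.
by case: eqP => // _; rewrite scaler0 addr0.
Qed.

Lemma hnorm_coord (y : l2 I H) n : hnorm (l2_fun y n) <= hnorm y.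
Proof. by have := l2_coord_norm y n; rewrite !normhE lecR. Qed.

Lemma coord_bop n : bop (fun y : l2 I H => l2_fun y n).
Proof. by split => //; exists 1 => // y; rewrite mul1r hnorm_coord. Qed.

(** Choose a finite set of coordinates carrying all but e^2 of the squared norm of [x]; restricting
    [x] to it removes exactly that share, by Pythagoras. *)
Lemma l2_tail (x : l2 I H) (e : R) : 0 < e -> exists2 s : seq I, uniq s &
  hnorm (x - \sum_(i <- s) l2_pt i (l2_fun x i)) < e.
Proof.
move=> e0; have e2 : 0 < e ^+ 2 by rewrite exprn_gt0.
have x0 i : 0 <= hnorm (l2_fun x i) ^+ 2 by exact: sqr_ge0.
have xf : nsum (fun i => hnorm (l2_fun x i) ^+ 2) \is a fin_num by rewrite -hnorm_l2E.
have [_ [X [finX _] <-]] := ub_ereal_sup_adherent e2 xf.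
rewrite -[ereal_sup _]/(nsum _) -hnorm_l2E fsbig_finite//= sumEFin -EFinB lte_fin.
set s := finmap.enum_fset _ => lt; have us : uniq s by exact: finmap.fset_uniq.
exists s => //; set y := \sum_(i <- s) _.
have yE i : l2_fun y i = if i \in s then l2_fun x i else 0.
  rewrite /y l2_sum; have [iS|iS] := boolP (i \in s).
    rewrite (bigD1_seq i)//= l2_ptE eqxx big1 ?addr0// => j ji.
    by rewrite l2_ptE eq_sym (negbTE ji).
  rewrite big_seq big1// => j js; rewrite l2_ptE; case: eqP => // ij.
  by rewrite ij js in iS.
rewrite -ltr_sqr ?nnegrE ?hnorm_ge0 ?(ltW e0)//.
pose f i := if i \in s then hnorm (l2_fun x i) ^+ 2 else 0.
have : (nsum (fun i => hnorm (l2_fun (x - y) i) ^+ 2 + f i)%R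
        = (hnorm x ^+ 2)%:E)%E.
  rewrite hnorm_l2E; congr nsum; apply/funext => i.
  rewrite -[l2_fun (x - y) i]/(l2_fun x i - l2_fun y i) yE /f.
  by case: ifP => _; rewrite ?subrr ?hnorm0 ?expr0n ?add0r// subr0 addr0.
have f0 i : 0 <= f i by rewrite /f; case: ifP.
rewrite nsumD//; last by move=> i; exact: sqr_ge0.
rewrite -hnorm_l2E => E.
have : ((hnorm (x - y) ^+ 2 + \sum_(i <- s) f i)%:E <= (hnorm x ^+ 2)%:E)%E.
  by rewrite -E EFinD leeD2l// nsum_ge.
rewrite (_ : \sum_(i <- s) f i = \sum_(i <- s) hnorm (l2_fun x i) ^+ 2).
  by rewrite lee_fin; move: lt; lra.
by rewrite big_seq [RHS]big_seq; apply: eq_bigr => i iS; rewrite /f iS.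
Qed.

End PointMass.

Section Separability.
Local Open Scope complex_scope.
Variable R : realType.

Lemma separableP (H : hilbert R) : separable H <->
  exists g : nat -> H, forall x (e : R), 0 < e -> exists n, hnorm (x - g n) < e.
Proof.
split=> [[D cD dD]|[g gd]].
  have /countable_injP[f finj] := cD.
  pose g n := xget 0 [set x | D x /\ f x = n].
  have gf x : D x -> g (f x) = x.
    move=> Dx; rewrite /g; case: xgetP => [y -> [Dy fy]|/(_ x)]; last by case.
    by apply: finj; rewrite ?inE.
  exists g => x e e0; have ec : 0 < e%:C by rewrite ltcR.
  have [y [+ Dy]] := dD (ball x e%:C) (ex_intro _ x (ballxx x ec)) (ball_open x e%:C).
  by rewrite -ball_normE /= normhE ltcR => xy; exists (f y); rewrite gf.
exists (range g); first by apply: (sub_countable (card_image_le _ _)); exact: countableP.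
move=> O [x Ox] oO.
have /nbhs_ballP[e /= e0 eO] : nbhs x O by exact: open_nbhs_nbhs.
have er : 0 < complex.Re e by move: e0; rewrite ltcE => /andP[].
have [n ln] := gd x _ er; exists (g n); split; last by exists n.
apply: eO; rewrite -ball_normE /= normhE -[e]RRe_real ?gtr0_real//.
by rewrite ltcR.
Qed.

(** Finite sums of point masses with values in a dense sequence are dense, and they are coded by the
    countable type [seq (I * nat)]. *)
Lemma l2_separable (I : countType) (H : hilbert R) :
  separable H -> separable (l2 I H).
Proof.
move=> /separableP[g gd]; apply/separableP.
pose F (s : seq (I * nat)) : l2 I H := \sum_(p <- s) l2_pt p.1 (g p.2).
exists (fun n => if unpickle n is Some s then F s else 0) => x e e0.
have e2 : 0 < e / 2 by rewrite divr_gt0.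
have [s us sx] := l2_tail x e2.
(* Half of the error is for the tail, half is shared among the coordinates; the successor covers the
   empty list. *)
have e3 : 0 < e / 2 / (size s).+1%:R by rewrite divr_gt0.
have [k kP] : exists k : I -> nat, forall i,
    hnorm (l2_fun x i - g (k i)) < e / 2 / (size s).+1%:R.
  exists (fun i => projT1 (cid (gd (l2_fun x i) _ e3))) => i.
  exact: (projT2 (cid (gd (l2_fun x i) _ e3))).
exists (pickle [seq (i, k i) | i <- s]); rewrite pickleK /F big_map /=.
set z := \sum_(i <- s) l2_pt i (l2_fun x i) in sx.
set w := \sum_(i <- s) _.
have zw : hnorm (z - w) <= e / 2.
  rewrite /z /w -sumrB; apply: le_trans (hnorm_sum _ _ _) _.
  apply: (@le_trans _ _ (\sum_(i <- s) e / 2 / (size s).+1%:R)).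
    apply: ler_sum => i _; apply: ltW; apply: le_lt_trans (kP i).
    by rewrite -(linB (l2_pt_bop H i).1) hnorm_pt.
  rewrite big_const_seq count_predT iter_addr_0 -[leLHS]mulr_natr.
  rewrite -[leLHS]mulrA ger_pMr//.
  by rewrite mulrC ler_pdivrMr// mul1r ler_nat.
have -> : x - w = (x - z) + (z - w) by rewrite addrA subrK.
apply: le_lt_trans (hnorm_triangle _ _) _.
by rewrite [ltRHS]splitr ltr_leD.
Qed.
End Separability.

(** * Finite direct sums of rotated tuples *)

Section DirectSum.
Local Open Scope complex_scope.
Variables (R : realType) (d : nat) (T : finType) (H : hilbert R).
Variables (e : T -> 'I_d -> R[i]) (U : 'I_d -> H -> H).
Hypotheses (einj : injective e) (e1 : forall a k, `|e a k| = 1).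
Hypothesis uU : unitary_tuple U.

Definition dsum (k : 'I_d) : l2 T H -> l2 T H := wcomp id (fun a => e a k *: U k).

Let scl k a : unitary_op (e a k *: U k).
Proof. exact: unitary_scale. Qed.

Let scl_hnorm k a h : hnorm ((e a k *: U k) h) <= 1 * hnorm h.
Proof. by rewrite mul1r unitary_hnorm. Qed.

Lemma dsumE k x a : l2_fun (dsum k x) a = e a k *: U k (l2_fun x a).
Proof.
by rewrite (@wcompE _ _ _ _ _ id id _ (fun=> erefl) (fun=> erefl) ler01 _ (scl_hnorm k)).
Qed.

Lemma dsum_unitary : unitary_tuple dsum.
Proof.
move=> k; apply: (@wcomp_unitary _ _ _ id id 1 _ (fun a => adj (e a k *: U k))) => //.
- by move=> a; exact: (unitary_bop (scl k a)).1.
- by move=> a; exact: (bop_adj _).1.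
- by move=> a h; rewrite mul1r unitary_adj_hnorm.
- by move=> a; exact: unitary_adjp.
- by move=> a; exact: unitary_adjK.
- by move=> a; exact: unitary_Kadj.
Qed.

(** Only the index changes: [e] is injective, so [T] is in bijection with the subtype of its range,
    and sums of squares are reindexed along this bijection. *)
Lemma dsum_is_direct_sum :
  is_direct_sum (fun l : range e => scale_tuple (\val l) U) dsum.
Proof.
pose tL (a : T) : range e := exist _ (e a) (mem_set (imageP e (I : setT a))).
have ex (l : range e) : exists a, e a = \val l.
  by case: l => l /= /set_mem [a _ <-]; exists a.
pose sL (l : range e) : T := projT1 (cid (ex l)).
have esL l : e (sL l) = \val l := projT2 (cid (ex l)).
have sLK : cancel sL tL by move=> l; apply: val_inj; rewrite /= esL.
have tLK : cancel tL sL by move=> a; apply: einj; rewrite esL.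
exists (fun x l => l2_fun x (sL l)); last by move=> k x l; rewrite dsumE esL.
split=> //.
- move=> x; rewrite hnorm_l2E.
  by rewrite -(nsum_reindex sLK tLK) // => a; exact: sqr_ge0.
- move=> f fs; exists (mkl2 (fun a => f (tL a))) => l; rewrite mkl2E ?sLK//.
  apply: sqr_summable_nsum.
  rewrite -(nsum_reindex sLK tLK) => [|a]; last exact: sqr_ge0.
  by move: fs; congr (_ < _)%E; apply: eq_esum => i _; rewrite sLK.
Qed.

Lemma range_torus : range e `<=` @torus R d.
Proof. by move=> _ [a _ <-] k; rewrite e1. Qed.

Lemma range_countable : countable (range e).
Proof. by apply: (sub_countable (card_image_le _ _)); exact: countableP. Qed.

End DirectSum.

(** * Ordered monomials *)

Section Phases.
Local Open Scope complex_scope.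
Variable R : realType.
Implicit Types t u : R.

Lemma expiD t u : expi (t + u) = expi t * expi u.
Proof.
by apply/eqP; rewrite eq_complex /= cosD sinD eqxx [sin t * _ + _]addrC eqxx.
Qed.

Lemma expi0 : expi 0 = 1 :> R[i].
Proof. by rewrite /expi cos0 sin0. Qed.

Lemma expiN t : expi (- t) = (expi t)^*%R.
Proof. by rewrite /expi cosN sinN. Qed.

Lemma norm_expi t : `|expi t| = 1.
Proof. by rewrite normc_def /= cos2Dsin2 sqrtr1. Qed.

Lemma hnorm_expiZ (H : hilbert R) t (x : H) : hnorm (expi t *: x) = hnorm x.
Proof. by rewrite hnormZ norm_expi mul1r. Qed.

Lemma expi_pi2M (k : nat) : expi (2 * pi * k%:R) = 1 :> R[i].
Proof.
elim: k => [|k IH]; first by rewrite mulr0 expi0.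
rewrite -[k.+1%:R]natr1 mulrDr mulr1 expiD IH mul1r /expi.
by rewrite mulr_natl cos2pi sin2pi.
Qed.

(** By the half angle: cos t = 1 - 2 sin^2 (t/2), and sin (t/2) > 0. *)
Lemma expi_neq1 t : 0 < t < 2 * pi -> expi t != 1.
Proof.
move=> /andP[t0 t1]; rewrite eq_complex /= negb_and; apply/orP; left.
have s0 : 0 < sin (t / 2).
  by apply: sin_gt0_pi; rewrite divr_gt0//= ltr_pdivrMr// mulrC.
have -> : t = t / 2 + t / 2 by rewrite -splitr.
rewrite cosD; have := cos2Dsin2 (t / 2).
by apply: contraPneq => h1 h2; nra.
Qed.

End Phases.

Section Bicharacter.
Variables (R : realType) (d : nat) (Theta : 'M[R]_d).

(* The exponent of the 2-cocycle by which ordered monomials of a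
   Theta-commuting tuple multiply. *)
Definition beta (r m : 'rV[int]_d) : R :=
  \sum_(i < d) \sum_(j < d | (j < i)%N) Theta j i * (r 0 j)%:~R * (m 0 i)%:~R.

Lemma betaDl r r' m : beta (r + r') m = beta r m + beta r' m.
Proof.
rewrite /beta -big_split; apply: eq_bigr => i _; rewrite -big_split /=.
by apply: eq_bigr => j _; rewrite mxE intrD; ring.
Qed.

Lemma betaDr r m m' : beta r (m + m') = beta r m + beta r m'.
Proof.
rewrite /beta -big_split; apply: eq_bigr => i _; rewrite -big_split /=.
by apply: eq_bigr => j _; rewrite mxE intrD; ring.
Qed.

Lemma betaNl r m : beta (- r) m = - beta r m.
Proof.
rewrite /beta -sumrN; apply: eq_bigr => i _; rewrite -sumrN.
by apply: eq_bigr => j _; rewrite mxE intrN; ring.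
Qed.

Lemma betaNr r m : beta r (- m) = - beta r m.
Proof.
rewrite /beta -sumrN; apply: eq_bigr => i _; rewrite -sumrN.
by apply: eq_bigr => j _; rewrite mxE intrN; ring.
Qed.

Definition ev (i : 'I_d) : 'rV[int]_d := delta_mx 0 i.

Lemma beta_evr r i : beta r (ev i) = \sum_(j < d | (j < i)%N) Theta j i * (r 0 j)%:~R.
Proof.
rewrite /beta (bigD1 i)//= [X in _ + X]big1 ?addr0 => [|k ki].
  by apply: eq_bigr => j _; rewrite mxE !eqxx mulr1.
by apply: big1 => j _; rewrite mxE (negbTE ki) mulr0.
Qed.

Lemma beta_ev k l : beta (ev k) (ev l) = if (k < l)%N then Theta k l else 0.
Proof.
rewrite beta_evr; case: ifP => kl.
  rewrite (bigD1 k)//= big1 => [|j /andP[_ jk]].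
    by rewrite mxE !eqxx mulr1 addr0.
  by rewrite mxE (negbTE jk) andbF mulr0.
apply: big1 => j jl; rewrite mxE; case: (j =P k) => [jk|_]; last by rewrite ?andbF mulr0.
by rewrite -jk jl in kl.
Qed.

(** For distinct indices only one of the two terms is nonzero; the sign of the second case and the
    vanishing of the diagonal are the antisymmetry of [Theta]. *)
Lemma beta_antisym k l : Theta^T = - Theta ->
  beta (ev k) (ev l) - beta (ev l) (ev k) = Theta k l.
Proof.
move=> hT; have aT i j : Theta i j = - Theta j i.
  by have /matrixP/(_ j i) := hT; rewrite !mxE.
rewrite !beta_ev; case: (ltngtP k l) => [_|_|/val_inj ->].
- by rewrite subr0.
- by rewrite sub0r -aT.
- by have := aT l l; lra.
Qed.

End Bicharacter.

Section Monomials.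
Local Open Scope complex_scope.
Variables (R : realType) (d : nat) (Theta : 'M[R]_d) (delta : R).
Variables (H : hilbert R) (U : 'I_d -> H -> H).
Hypothesis uU : unitary_tuple U.

(** Defined along any list of indices to allow induction; the head of the list is the leftmost
    factor, applied last. *)
Definition mono_seq (s : seq 'I_d) (m : 'I_d -> nat) (x : H) : H :=
  foldr (fun j y => iter (m j) (U j) y) x s.

Definition mono := mono_seq (enum 'I_d).

Definition bump1 (i : 'I_d) (m : 'I_d -> nat) : 'I_d -> nat :=
  fun j => (m j + (j == i))%N.

Definition zrow (m : 'I_d -> nat) : 'rV[int]_d := \row_j (m j)%:Z.

Lemma zrow_bump1 i m : zrow (bump1 i m) = zrow m + ev i.
Proof. by apply/rowP => j; rewrite !mxE eqxx PoszD; case: (j == i). Qed.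

Lemma mono_seq_unitary s m : unitary_op (mono_seq s m).
Proof.
elim: s => [|j s IH]; first exact: unitary_id.
exact: (unitary_comp (unitary_iter (m j) (uU j)) IH).
Qed.

Lemma mono_unitary m : unitary_op (mono m).
Proof. exact: mono_seq_unitary. Qed.

Lemma mono_seq_eq s m m' : {in s, m =1 m'} -> mono_seq s m =1 mono_seq s m'.
Proof.
elim: s => // j s IH e x; rewrite -[LHS]/(iter (m j) (U j) (mono_seq s m x)).
rewrite IH => [|k ks]; first by rewrite (e j (mem_head _ _)).
by apply: e; rewrite inE ks orbT.
Qed.

Hypothesis delta0 : 0 <= delta.
Hypothesis hU : forall i j : 'I_d,
  (opnorm (U i \o U j - expi (Theta j i) *: (U j \o U i)) <= delta%:E)%E.

Let Ul i : linear (U i) := (unitary_bop (uU i)).1.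

Lemma comm_le i j x :
  hnorm (U i (U j x) - expi (Theta j i) *: U j (U i x)) <= delta * hnorm x.
Proof.
have := opnorm_le_inv _ (hU i j); apply.
move=> a y z; rewrite -[LHS]/(U i (U j (a *: y + z)) - expi (Theta j i) *: U j (U i (a *: y + z))).
rewrite -[RHS]/(a *: (U i (U j y) - expi (Theta j i) *: U j (U i y))
  + (U i (U j z) - expi (Theta j i) *: U j (U i z))).
rewrite !Ul !scalerDr !scalerN !scalerA [a * _]mulrC opprD.
by rewrite -!addrA; congr (_ + _); rewrite addrCA.
Qed.

Lemma comm_iter_le i j k x :
  hnorm (U i (iter k (U j) x) - expi (k%:R * Theta j i) *: iter k (U j) (U i x))
  <= k%:R * delta * hnorm x.
Proof.
elim: k => [|k IH]; first by rewrite /= mul0r expi0 scale1r subrr hnorm0 !mul0r.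
rewrite /=; set y := iter k (U j) x in IH *; set z := iter k (U j) (U i x) in IH *.
have -> : U i (U j y) - expi (k.+1%:R * Theta j i) *: U j z
   = (U i (U j y) - expi (Theta j i) *: U j (U i y))
     + expi (Theta j i) *: U j (U i y - expi (k%:R * Theta j i) *: z).
  rewrite (linB (Ul j)) (linZ (Ul j)) scalerBr scalerA -expiD.
  by rewrite addrA subrK -natr1 mulrDl mul1r [_ + Theta j i]addrC.
apply: le_trans (hnorm_triangle _ _) _.
rewrite hnorm_expiZ (unitary_hnorm _ (uU j)) -[k.+1%:R]natr1 !mulrDl addrC lerD//.
apply: le_trans (comm_le _ _ _) _.
by rewrite mul1r /y (unitary_hnorm _ (unitary_iter k (uU j))).
Qed.

(** [U i] travels from the left past the blocks with j < i, each single exchange costing [delta] and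
    a phase, until it meets the block of [U i] and joins it without error. Since the list increases,
    the blocks behind that one have larger indices and are never crossed. *)
Lemma mono_seq_comm s i m x : pairwise (fun a b : 'I_d => (a < b)%N) s -> i \in s ->
  hnorm (U i (mono_seq s m x)
    - expi (\sum_(j <- s | (j < i)%N) Theta j i * (m j)%:R) *: mono_seq s (bump1 i m) x)
  <= delta * (\sum_(j <- s | (j < i)%N) (m j)%:R) * hnorm x.
Proof.
elim: s => //= j s IH /andP[js ps]; rewrite inE !big_cons.
have [ij _|ij /= iS] := eqVneq i j.
  subst j.
  have js' k : k \in s -> (k < i)%N = false.
    by move=> ks; move/allP : js => /(_ k ks) h; apply/negbTE; rewrite -leqNgt ltnW.
  have e0 (f : 'I_d -> R) : \sum_(k <- s | (k < i)%N) f k = 0.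
    by rewrite big_seq_cond big1// => k /andP[ks]; rewrite js'.
  rewrite ltnn !e0 expi0 scale1r mulr0 mul0r.
  rewrite (@mono_seq_eq s (bump1 i m) m) => [|k ks]; last first.
    rewrite /bump1; case: eqP => [ki|]; last by rewrite addn0.
    by move/allP : js => /(_ k ks); rewrite ki ltnn.
  by rewrite /bump1 eqxx addn1 iterS subrr hnorm0.
have ji : (j < i)%N by move/allP : js => /(_ i iS).
rewrite ji; set S := \sum_(k <- s | _) _; set N := \sum_(k <- s | _) _.
rewrite /bump1 eq_sym (negbTE ij) addn0 -/(bump1 i m).
set y := mono_seq s m x; set z := mono_seq s _ x.
have uI := unitary_iter (m j) (uU j).
(* The error splits into crossing the block of [U j] and the induction hypothesis, carried inside a
   phase and a unitary, which preserve norms. *)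
have -> : U i (iter (m j) (U j) y) - expi (Theta j i * (m j)%:R + S) *: iter (m j) (U j) z
   = (U i (iter (m j) (U j) y) - expi ((m j)%:R * Theta j i) *: iter (m j) (U j) (U i y))
     + expi ((m j)%:R * Theta j i) *: iter (m j) (U j) (U i y - expi S *: z).
  rewrite (linB (unitary_bop uI).1) (linZ (unitary_bop uI).1) scalerBr scalerA -expiD.
  by rewrite addrA subrK (mulrC (Theta j i)).
apply: le_trans (hnorm_triangle _ _) _.
rewrite hnorm_expiZ (unitary_hnorm _ uI) mulrDr mulrDl lerD ?IH//.
apply: le_trans (comm_iter_le _ _ _ _) _.
by rewrite /y (unitary_hnorm _ (mono_seq_unitary s m)) [delta * _]mulrC.
Qed.

Lemma mono_comm i m x :
  hnorm (U i (mono m x) - expi (beta Theta (zrow m) (ev i)) *: mono (bump1 i m) x)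
  <= delta * (\sum_(j < d | (j < i)%N) (m j)%:R) * hnorm x.
Proof.
have pe : pairwise (fun a b : 'I_d => (a < b)%N) (enum 'I_d).
  rewrite -(pairwise_map val ltn) val_enum_ord -sorted_pairwise ?iota_ltn_sorted//.
  exact: ltn_trans.
have := mono_seq_comm m x pe (mem_enum _ i).
rewrite beta_evr !big_enum_cond /=.
rewrite [X in expi X](_ : _
  = \sum_(j < d | (j < i)%N) Theta j i * (zrow m 0 j)%:~R) //.
by apply: eq_bigr => j _; rewrite mxE.
Qed.

End Monomials.

(** * Counting and averaging over a box of exponents *)

Section Box.
Variables (R : realType) (d p : nat) (B : 'I_d -> nat).
Hypotheses (B0 : forall j, (0 < B j)%N) (Bp : forall j, (B j <= p.+1)%N).
Notation index := {ffun 'I_d -> 'I_p.+1}.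
Implicit Type m : index.

Definition box : pred index := family (fun j => [pred k : 'I_p.+1 | (k < B j)%N]).

Lemma boxP m : reflect (forall j, (m j < B j)%N) (m \in box).
Proof.
by apply: (iffP familyP) => h j; have := h j; rewrite inE.
Qed.

Lemma card_initial n : (n <= p.+1)%N -> #|[pred k : 'I_p.+1 | (k < n)%N]| = n.
Proof.
move=> np; have inj : injective (widen_ord np) by move=> a b /(congr1 val) /= /val_inj.
rewrite -[RHS](card_ord n) -(card_codom inj); apply: eq_card => k; rewrite !inE.
apply/idP/codomP => [kn|[a ->]]; last exact: (ltn_ord a).
by exists (Ordinal kn); apply: val_inj.
Qed.

Lemma card_box : #|box| = (\prod_j B j)%N.
Proof.
rewrite card_family /image_mem foldrE big_map big_enum /=.
by apply: eq_bigr => j _; rewrite card_initial.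
Qed.

Lemma card_box_gt0 : (0 < #|box|)%N.
Proof. by rewrite card_box; apply: prodn_gt0. Qed.

(** The far face is again a product set, with one value left in direction [i]; it is the fraction
    1/B_i of the box. *)
Lemma card_box_last i : (#|[pred m in box | (m i).+1 == B i]| * B i)%N = #|box|.
Proof.
have lt : ((B i).-1 < p.+1)%N by rewrite prednK.
rewrite (@eq_card _ _ (family (fun j => if j == i then pred1 (Ordinal lt)
    else [pred k : 'I_p.+1 | (k < B j)%N]))); last first.
  move=> m; rewrite inE /=; apply/andP/familyP => [[/boxP mb /eqP mi] j|mf].
    case: eqP => [->|_]; last by rewrite inE.
    by rewrite !inE; apply/eqP/val_inj; rewrite /= -mi.
  have mi : m i = Ordinal lt by have := mf i; rewrite eqxx inE => /eqP.
  split; last by rewrite mi /= prednK.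
  apply/boxP => j; have := mf j; case: eqP => [->|_]; last by rewrite inE.
  by rewrite inE => /eqP ->; rewrite /= prednK.
rewrite card_box card_family /image_mem foldrE big_map big_enum /=.
rewrite [RHS](bigD1 i)//= (bigD1 i)//= eqxx card1 mul1n mulnC; congr (_ * _)%N.
by apply: eq_bigr => j /negbTE ji; rewrite ji card_initial.
Qed.

(** The reflection [f] of the box turns [m j] into B_j - 1 - [m j], so a coordinate averages (B_j -
    1)/2. This halving of the commutator cost leaves room for the boundary term in the final
    bound. *)
Lemma sum_box_coord j :
  (\sum_(m in box) (m j)%:R) + (\sum_(m in box) (m j)%:R) = #|box|%:R * ((B j).-1)%:R :> R.
Proof.
pose f m : index := [ffun k => inord ((B k).-1 - m k)].
have fv m k : m \in box -> f m k = ((B k).-1 - m k)%N :> nat.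
  move=> /boxP mb; rewrite ffunE inordK// (leq_trans _ (Bp k))//.
  by rewrite (leq_ltn_trans (leq_subr _ _))// prednK.
have mlt m k : m \in box -> (m k <= (B k).-1)%N.
  by move=> /boxP/(_ k) h; rewrite -ltnS prednK.
have fb m : m \in box -> f m \in box.
  move=> mb; apply/boxP => k; rewrite fv//.
  by rewrite (leq_ltn_trans (leq_subr _ _))// prednK.
have ff m : m \in box -> f (f m) = m.
  move=> mb; apply/ffunP => k; apply: val_inj; rewrite /= !fv ?fb//.
  by rewrite subKn ?mlt.
rewrite {1}(reindex_onto f f) //= (eq_bigl (mem box)) => [|m]; last first.
  apply/andP/idP => [[mb /eqP <-]|mb]; first exact: fb.
  by rewrite fb// ff.
rewrite -big_split /= (eq_bigr (fun=> ((B j).-1)%:R)) => [|m mb].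
  by rewrite sumr_const mulr_natl.
by rewrite fv// -natrD subnK// mlt.
Qed.

Variables (delta : R).
Hypothesis delta0 : 0 <= delta.

(* Bounds the error made at [m] when [U i] is moved past [mono m]; at the far
   face of the box the shifted index is lost altogether. *)
Definition cost i m : R :=
  if ((m i).+1 < B i)%N then delta * \sum_(j < d | (j < i)%N) (m j)%:R else 1.

(** The far face contributes 1 for each of its points; the commutator cost of the other points is
    bounded by its sum over the whole box, where coordinate averages are available. *)
Lemma box_cost i : \sum_(m in box) cost i m
  <= #|box|%:R * ((B i)%:R^-1 + delta * (\sum_(j < d | (j < i)%N) ((B j).-1)%:R) / 2).
Proof.
rewrite mulrDr.
have Bi : (B i)%:R != 0 :> R by rewrite pnatr_eq0 -lt0n.
have -> : #|box|%:R * (B i)%:R^-1 = #|[pred m in box | (m i).+1 == B i]|%:R :> R.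
  by rewrite -(card_box_last i) natrM mulfK.
rewrite (bigID (fun m : index => (m i).+1 == B i)) /= lerD//.
  rewrite (eq_bigr (fun=> 1)) => [|m /andP[_ /eqP e]]; last by rewrite /cost e ltnn.
  rewrite sumr_const ler_nat; apply/eq_leq/eq_card => m.
  by rewrite !inE.
apply: (@le_trans _ _ (\sum_(m in box) delta * \sum_(j < d | (j < i)%N) (m j)%:R)).
  rewrite [leRHS](bigID (fun m : index => (m i).+1 == B i)) /= -[leLHS]add0r lerD//.
    by apply: sumr_ge0 => m _; rewrite mulr_ge0// sumr_ge0.
  apply: ler_sum => m /andP[/boxP mb mi].
  by rewrite /cost ltn_neqAle mi mb.
rewrite -mulr_sumr exchange_big /= mulrCA -mulrA ler_wpM2l//.
rewrite mulr_suml; apply: ler_sum => j _.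
by have := sum_box_coord j; lra.
Qed.

End Box.

(** * Twisted shifts and finite Fourier transform *)

Section TwistedShift.
Local Open Scope complex_scope.
Variables (R : realType) (d : nat) (Theta : 'M[R]_d) (H : hilbert R).
Local Notation J := 'rV[int]_d.

Definition tshift (i : 'I_d) : l2 J H -> l2 J H :=
  wcomp (fun n : J => n - ev i) (fun n h => expi (beta Theta (n - ev i) (ev i)) *: h).

Let shK i : cancel (fun n : J => n - ev i) (fun n => n + ev i).
Proof. by move=> n; rewrite subrK. Qed.

Let shK' i : cancel (fun n : J => n + ev i) (fun n => n - ev i).
Proof. by move=> n; rewrite addrK. Qed.

Lemma tshiftE i x n : l2_fun (tshift i x) n
  = expi (beta Theta (n - ev i) (ev i)) *: l2_fun x (n - ev i).
Proof.
by apply: (wcompE (shK i) (shK' i) ler01) => j h; rewrite hnorm_expiZ mul1r.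
Qed.

Lemma phase_linear t : linear (fun h : H => expi t *: h).
Proof. by move=> a x y; rewrite scalerDr !scalerA mulrC. Qed.

Lemma phase_adjp t : adjp (fun h : H => expi t *: h) (fun h => expi (- t) *: h).
Proof. by move=> x y; rewrite innerZl innerZr expiN conjCK. Qed.

Lemma phaseK t : cancel (fun h : H => expi t *: h) (fun h => expi (- t) *: h).
Proof. by move=> x; rewrite scalerA -expiD addNr expi0 scale1r. Qed.

Lemma tshift_unitary : unitary_tuple tshift.
Proof.
move=> i; apply: (@wcomp_unitary _ _ _ _ _ 1 _
  (fun n h => expi (- beta Theta (n - ev i) (ev i)) *: h) (shK i) (shK' i)) => //.
- by move=> n; exact: phase_linear.
- by move=> n; exact: phase_linear.
- by move=> n h; rewrite hnorm_expiZ mul1r.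
- by move=> n h; rewrite hnorm_expiZ mul1r.
- by move=> n; exact: phase_adjp.
- by move=> n; exact: phaseK.
- move=> n x; have := phaseK (- beta Theta (n - ev i) (ev i)) x.
  by rewrite opprK.
Qed.

(** Both orders translate by the same vector; by bilinearity their phases differ by beta(e_k, e_l) -
    beta(e_l, e_k), whatever the position [n]. *)
Lemma tshift_commuting : Theta^T = - Theta -> theta_commuting Theta tshift.
Proof.
move=> hT k l; apply/funext => x; apply: l2_ext => n.
rewrite -[RHS]/(expi (Theta k l) *: l2_fun (tshift k (tshift l x)) n).
rewrite !tshiftE !scalerA -!expiD addrAC; congr (expi _ *: _).
rewrite -(beta_antisym k l hT) !betaDl !betaNl; lra.
Qed.

End TwistedShift.

Section Characters.
Local Open Scope complex_scope.
Variables (R : realType) (d p : nat) (H : hilbert R).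
Local Notation J := 'rV[int]_d.
Local Notation index := {ffun 'I_d -> 'I_p.+1}.

Let tau : R := 2 * pi / p.+1%:R.

Definition chi (a : index) (n : J) : R[i] :=
  expi (\sum_j tau * (a j)%:R * (n 0 j)%:~R).

Definition torus_pt (a : index) (k : 'I_d) : R[i] := expi (tau * (a k)%:R).

Lemma expi_sum (I : Type) (s : seq I) (P : pred I) (f : I -> R) :
  expi (\sum_(i <- s | P i) f i) = \prod_(i <- s | P i) expi (f i).
Proof. exact: (big_morph (@expi R) (@expiD R) (expi0 R)). Qed.

Lemma expi_natM (k : nat) (t : R) : expi (k%:R * t) = expi t ^+ k.
Proof.
elim: k => [|k IH]; first by rewrite mul0r expi0.
by rewrite -[k.+1%:R]natr1 mulrDl mul1r expiD IH exprSr.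
Qed.

Lemma expi_pi2z (k : int) : expi (2 * pi * k%:~R) = 1 :> R[i].
Proof.
case: k => k; first exact: expi_pi2M.
by rewrite NegzE intrN mulrN expiN expi_pi2M conjC1.
Qed.

Lemma tau_p : tau * p.+1%:R = 2 * pi.
Proof. by rewrite /tau divfK// pnatr_eq0. Qed.

Lemma expi_tau_neq1 (r : nat) : (0 < r < p.+1)%N -> expi (tau * r%:R) != 1.
Proof.
move=> /andP[r0 rp]; apply: expi_neq1; rewrite -tau_p.
have t0 : 0 < tau by rewrite /tau divr_gt0// mulr_gt0// pi_gt0.
by rewrite mulr_gt0 ?ltr0n//= ltr_pM2l// ltr_nat.
Qed.

(** Makes the direct sum one over a set of torus points, without repetitions. Distinct residues
    differ by less than p + 1, so their phases differ. *)
Lemma torus_pt_inj : injective torus_pt.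
Proof.
have le (a b : 'I_p.+1) : (b <= a)%N -> expi (tau * a%:R) = expi (tau * b%:R) -> a = b.
  move=> ba e; apply/val_inj/eqP; rewrite /= eqn_leq ba andbT leqNgt.
  apply/negP => lt; have := @expi_tau_neq1 (a - b).
  rewrite subn_gt0 lt (leq_ltn_trans (leq_subr _ _) (ltn_ord a)) => /(_ isT)/eqP; apply.
  by rewrite natrB// mulrBr expiD e -expiD subrr expi0.
move=> a b ab; apply/ffunP => k; have := congr1 (fun f => f k) ab; rewrite /torus_pt.
by case: (leqP (b k) (a k)) => [/le h /h //|/ltnW/le h /esym/h].
Qed.

Lemma torus_pt_norm a k : `|torus_pt a k| = 1.
Proof. exact: norm_expi. Qed.

Lemma chiD a n m : chi a (n + m) = chi a n * chi a m.
Proof.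
rewrite /chi -expiD -big_split /=; congr expi; apply: eq_bigr => j _.
by rewrite mxE intrD mulrDr.
Qed.

Lemma chiN a n : chi a (- n) = (chi a n)^*%R.
Proof.
rewrite /chi -expiN -sumrN; congr expi; apply: eq_bigr => j _.
by rewrite mxE intrN mulrN.
Qed.

Lemma chi_ev a k : chi a (ev k) = torus_pt a k.
Proof.
rewrite /chi /torus_pt (bigD1 k)//= mxE !eqxx mulr1 big1 ?addr0// => j jk.
by rewrite mxE (negbTE jk) mulr0.
Qed.

(** The sum factors over the coordinates. A coordinate divisible by p + 1 gives p + 1; any other
    gives the geometric sum of a nontrivial root of unity, which vanishes. *)
Lemma sum_chi (n : J) :
  \sum_a chi a n = if [forall j, (p.+1 %| n 0%R j)%Z] then #|{: index}|%:R else 0.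
Proof.
have -> : \sum_a chi a n = \prod_j \sum_(k < p.+1) expi (tau * k%:R * (n 0 j)%:~R).
  by rewrite bigA_distr_bigA /=; apply: eq_bigr => a _; rewrite /chi expi_sum.
case: ifPn => [/forallP dv|].
  have -> : #|{: index}|%:R = \prod_(j < d) p.+1%:R :> R[i].
    by rewrite card_ffun !card_ord natrX prodr_const card_ord.
  apply: eq_bigr => j _; rewrite (eq_bigr (fun=> 1)) => [|k _].
    by rewrite sumr_const card_ord.
  have /dvdzP[q ->] := dv j.
  rewrite (_ : _ * _ = 2 * pi * (q * (k : nat)%:Z)%:~R) ?expi_pi2z//.
  by rewrite -tau_p !intrM /=; ring.
rewrite negb_forall => /existsP[j nd]; apply/eqP; rewrite prodf_seq_eq0.
apply/hasP; exists j; first exact: mem_index_enum.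
rewrite /=; set w := expi (tau * (n 0 j)%:~R).
have wk k : expi (tau * k%:R * (n 0 j)%:~R) = w ^+ k.
  by rewrite /w -expi_natM; congr expi; ring.
(* Modulo p + 1 the exponent is a residue [r] with 0 < r < p + 1, and the discarded multiple of p +
   1 contributes a full turn. *)
have w1 : w != 1.
  have p0 : (p.+1 != 0 :> int) by [].
  have m0 := modz_ge0 (n 0 j) p0.
  have mlt : (n 0%R j %% p.+1 < p.+1)%Z by exact: ltz_pmod.
  case: (n 0%R j %% p.+1)%Z (divz_eq (n 0 j) p.+1) m0 mlt => // r e _ rlt.
  have r0 : (0 < r)%N.
    rewrite lt0n; apply: contra nd => /eqP r0; rewrite e r0 addr0.
    exact: dvdz_mull.
  have {}rlt : (r < p.+1)%N by exact: rlt.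
  have := @expi_tau_neq1 r; rewrite r0 rlt => /(_ isT).
  rewrite /w e intrD mulrDr expiD (_ : tau * (_ * _)%:~R = 2 * pi * (n 0%R j %/ p.+1)%Z%:~R).
    by rewrite expi_pi2z mul1r.
  by rewrite -tau_p intrM; ring.
have wp : w ^+ p.+1 = 1.
  by rewrite /w -expi_natM mulrA [p.+1%:R * _]mulrC tau_p expi_pi2z.
rewrite (eq_bigr (fun k : 'I_p.+1 => w ^+ k)) => [|k _]; last exact: wk.
have := subrX1 w p.+1; rewrite wp subrr => /esym/eqP.
by rewrite mulf_eq0 subr_eq0 (negbTE w1).
Qed.

Let c1 : R[i] := (Num.sqrt (#|{: index}|%:R^-1 : R))%:C.

Let c1_conj : c1^*%R = c1.
Proof. by rewrite geC0_conj// ler0c sqrtr_ge0. Qed.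

Let cardI : #|{: index}|%:R != 0 :> R[i].
Proof.
rewrite pnatr_eq0 -lt0n; apply/card_gt0P.
by exists [ffun=> ord0].
Qed.

Let c1_sqr : c1 * c1 = #|{: index}|%:R^-1.
Proof.
rewrite /c1 -rmorphM /= -expr2 sqr_sqrtr ?invr_ge0//.
by rewrite fmorphV /= rmorph_nat.
Qed.

(** A copy of [H] along the normalized character at [n]. Copies at positions that are incongruent
    modulo p + 1 are orthogonal, so this stores a position in finitely many coordinates. *)
Definition fourier (n : J) : H -> l2 index H :=
  \sum_(a : index) (c1 * chi a n) *: l2_pt a.

Definition fourier_adj (n : J) : l2 index H -> H :=
  \sum_(a : index) (c1 * (chi a n)^*%R) *: (fun y => l2_fun y a).

Lemma fourierE n h a : l2_fun (fourier n h) a = (c1 * chi a n) *: h.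
Proof.
rewrite /fourier fun_sumE l2_sum (bigD1 a)//= big1 => [|b ba].
  by rewrite addr0 -[LHS]/((c1 * chi a n) *: l2_fun (l2_pt a h) a) l2_ptE eqxx.
by rewrite -[LHS]/((c1 * chi b n) *: l2_fun (l2_pt b h) a) l2_ptE eq_sym (negbTE ba) scaler0.
Qed.

Lemma fourier_bop n : bop (fourier n).
Proof. by apply: bop_sum => a; apply: bopZ; exact: l2_pt_bop. Qed.

Lemma fourier_adj_bop n : bop (fourier_adj n).
Proof. by apply: bop_sum => a; apply: bopZ; exact: coord_bop. Qed.

Lemma fourier_adjp n : adjp (fourier n) (fourier_adj n).
Proof.
move=> h y; rewrite inner_l2 csum_fin /fourier_adj fun_sumE inner_sumr.
apply: eq_bigr => a _; rewrite fourierE innerZl.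
rewrite -[(_ *: _) y]/((c1 * (chi a n)^*%R) *: l2_fun y a) innerZr.
by rewrite rmorphM /= conjCK c1_conj.
Qed.

Lemma fourier_ortho n n' h : fourier_adj n (fourier n' h)
  = if [forall j, (p.+1 %| (n' - n)%R 0%R j)%Z] then h else 0.
Proof.
rewrite /fourier_adj fun_sumE.
rewrite (eq_bigr (fun a => (#|{: index}|%:R^-1 * chi a (n' - n)) *: h)) => [|a _].
  rewrite -scaler_suml -mulr_sumr sum_chi; case: ifP => _.
    by rewrite mulVf ?scale1r.
  by rewrite mulr0 scale0r.
rewrite -[LHS]/((c1 * (chi a n)^*%R) *: l2_fun (fourier n' h) a).
rewrite fourierE scalerA chiD chiN -c1_sqr.
by congr (_ *: _); ring.
Qed.

Lemma hnorm_fourier n h : hnorm (fourier n h) = hnorm h.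
Proof.
apply: (adjp_hnorm (fourier_adjp n)); rewrite fourier_ortho.
case: ifPn => // /negP[]; apply/forallP => j.
by rewrite subrr mxE dvdz0.
Qed.

(** Adjoint of an isometry E: |E'y|^2 = (E E'y, y) <= |E'y| |y|, then divide. *)
Lemma hnorm_fourier_adj n y : hnorm (fourier_adj n y) <= hnorm y.
Proof.
have [->|y0] := eqVneq (hnorm (fourier_adj n y)) 0; first exact: hnorm_ge0.
have yp : 0 < hnorm (fourier_adj n y) by rewrite lt_def y0 hnorm_ge0.
rewrite -(ler_pM2l yp) -expr2 -lecR hnorm_sqr -fourier_adjp.
rewrite -[leLHS]ger0_norm.
  by apply: le_trans (inner_le _ _) _; rewrite hnorm_fourier.
by rewrite fourier_adjp; exact: dnorm_ge0.
Qed.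

(** The [k]-th coordinate of a torus point is the value of its character at [ev k], so the rotation
    multiplies characters and translates the stored position. *)
Lemma dsum_fourier (U : 'I_d -> H -> H) k n h : unitary_tuple U ->
  dsum torus_pt U k (fourier n h) = fourier (n + ev k) (U k h).
Proof.
move=> uU; apply: l2_ext => a; rewrite (dsumE torus_pt_norm)// !fourierE.
rewrite (linZ (unitary_bop (uU k)).1) scalerA chiD chi_ev.
by congr (_ *: _); ring.
Qed.

End Characters.

(** * The two dilations *)

Section AdjointSums.
Local Open Scope complex_scope.
Variable R : realType.
Implicit Types H L : hilbert R.

Lemma adjp_sum H L (T : Type) (s : seq T) (P : pred T) (F : T -> H -> L) F' :
  (forall i, adjp (F i) (F' i)) ->
  adjp (\sum_(i <- s | P i) F i) (\sum_(i <- s | P i) F' i).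
Proof.
move=> FF x y; rewrite !fun_sumE inner_suml inner_sumr.
by apply: eq_bigr => i _; exact: FF.
Qed.

Lemma adjp_scaler H L (c : R) (S : H -> L) S' : adjp S S' ->
  adjp (c%:C *: S) (c%:C *: S').
Proof.
move=> SS x y; rewrite -[(_ *: S) x]/(c%:C *: S x) -[(_ *: S') y]/(c%:C *: S' y).
by rewrite innerZl innerZr SS (_ : c%:C^*%R = c%:C)//; exact: conjc_real.
Qed.

Lemma adjp_comp H L (K : hilbert R) (S : K -> L) (T : H -> K) S' T' :
  adjp S S' -> adjp T T' -> adjp (S \o T) (T' \o S').
Proof. by move=> SS TT x y; rewrite /= SS TT. Qed.

(** For errors bounded fibre by fibre against a translate of the vector, as in
    [fourier_embed_close]. *)
Lemma l2_dom (I : choiceType) H (s t : I -> I) (C : R) (x y : l2 I H) :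
  cancel s t -> cancel t s -> 0 <= C ->
  (forall i, hnorm (l2_fun y i) <= C * hnorm (l2_fun x (s i))) ->
  hnorm y <= C * hnorm x.
Proof.
move=> st ts C0 le.
rewrite -ler_sqr ?nnegrE ?mulr_ge0 ?hnorm_ge0// -lee_fin.
have x0 j : 0 <= C ^+ 2 * hnorm (l2_fun x j) ^+ 2 by rewrite mulr_ge0 ?sqr_ge0.
rewrite exprMn [leRHS]EFinM !hnorm_l2E -nsumZ ?sqr_ge0// => [|j]; last exact: sqr_ge0.
rewrite -(nsum_reindex st ts x0); apply: le_nsum => i.
by rewrite -exprMn ler_sqr ?nnegrE ?mulr_ge0 ?hnorm_ge0.
Qed.

End AdjointSums.

Section Dilations.
Local Open Scope complex_scope.
Variables (R : realType) (d p : nat) (Theta : 'M[R]_d) (delta : R).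
Variables (H : hilbert R) (U : 'I_d -> H -> H) (B : 'I_d -> nat).
Hypotheses (uU : unitary_tuple U) (delta0 : 0 <= delta).
Hypothesis hU : forall i j : 'I_d,
  (opnorm (U i \o U j - expi (Theta j i) *: (U j \o U i)) <= delta%:E)%E.
Hypotheses (B0 : forall j, (0 < B j)%N) (Bp : forall j, (B j <= p)%N).
Local Notation J := 'rV[int]_d.
Local Notation index := {ffun 'I_d -> 'I_p.+1}.
Local Notation box := (@box d p B).

Let Bp1 j : (B j <= p.+1)%N. Proof. exact: leqW. Qed.

Definition nval (m : index) : 'I_d -> nat := fun j => m j.
Definition ipos (m : index) : J := zrow (nval m).
Definition imono (m : index) : H -> H := mono U (nval m).
Definition ibump (i : 'I_d) (m : index) : index :=
  [ffun j => inord (bump1 i (nval m) j)].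

Lemma imono_unitary m : unitary_op (imono m).
Proof. exact: mono_unitary. Qed.

Lemma ibump_nval i m : m \in box -> ((m i).+1 < B i)%N ->
  nval (ibump i m) = bump1 i (nval m).
Proof.
move=> /boxP mb lt; apply/funext => j; rewrite /nval ffunE inordK//.
rewrite /bump1 /nval; case: eqP => [->|_].
  by rewrite addn1 (leq_trans lt).
by rewrite addn0 ltn_ord.
Qed.

Lemma ibump_box i m : m \in box -> ((m i).+1 < B i)%N -> ibump i m \in box.
Proof.
move=> mb lt; apply/boxP => j.
rewrite -[nat_of_ord _]/(nval (ibump i m) j) ibump_nval// /bump1 /nval.
case: eqP => [->|_]; first by rewrite addn1.
by rewrite addn0; apply/boxP: j.
Qed.

Lemma ipos_ibump i m : m \in box -> ((m i).+1 < B i)%N ->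
  ipos (ibump i m) = ipos m + ev i.
Proof. by move=> mb lt; rewrite /ipos ibump_nval// zrow_bump1. Qed.

Lemma ipos_inj : injective ipos.
Proof.
move=> m m' e; apply/ffunP => j; apply: val_inj.
by have /rowP/(_ j) := e; rewrite !mxE => -[].
Qed.

(** The positions that the characters of the group of order (p + 1)^d cannot tell apart. *)
Definition pcong (n n' : J) : bool := [forall j, (p.+1 %| (n' - n)%R 0%R j)%Z].

Lemma pcong_nat (a b : nat) : (a < p.+1)%N -> (b < p.+1)%N ->
  (p.+1 %| a%:Z - b%:Z)%Z -> a = b.
Proof.
move=> ap bp; rewrite -eqz_mod_dvd !modz_nat !modn_small// => /eqP[].
by [].
Qed.

Lemma pcong_eq m m' : pcong (ipos m') (ipos m) = (m' == m).
Proof.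
apply/forallP/eqP => [h|-> j]; last by rewrite subrr mxE dvdz0.
apply/ffunP => j; apply: val_inj; apply/esym/pcong_nat; rewrite ?ltn_ord//.
by have := h j; rewrite !mxE.
Qed.

(* No wrap-around modulo [p.+1]: the entries of [ipos m + ev i] are at most [p]. *)
Lemma pcong_bump i m m' : m \in box -> m' \in box ->
  pcong (ipos m') (ipos m + ev i) = ((m i).+1 < B i)%N && (m' == ibump i m).
Proof.
move=> mb mb'.
have hv j : (ipos m + ev i) 0 j = (bump1 i (nval m) j)%:Z.
  by rewrite -zrow_bump1 mxE.
apply/idP/andP => [/forallP h|[lt /eqP ->]]; last first.
  by rewrite -ipos_ibump//; have := pcong_eq (ibump i m) (ibump i m); rewrite eqxx => ->.
have e j : bump1 i (nval m) j = m' j.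
  apply: pcong_nat.
  - rewrite /bump1 /nval; move/boxP : (mb) => /(_ j) lt.
    case: eqP => _; last by rewrite addn0; exact: ltn_ord.
    by rewrite addn1 ltnS; exact: leq_trans lt (Bp j).
  - exact: ltn_ord.
  - by have := h j; rewrite mxE hv !mxE.
have lt : ((m i).+1 < B i)%N.
  by move/boxP : (mb') => /(_ i); rewrite -e /bump1 eqxx addn1.
split=> //; apply/eqP/ffunP => j; apply: val_inj.
by rewrite /= -[in RHS]/(nval (ibump i m) j) ibump_nval// e.
Qed.

Let nu : R := #|box|%:R^-1.
Let c0 : R := Num.sqrt nu.

Let boxn0 : #|box|%:R != 0 :> R.
Proof. by rewrite pnatr_eq0 -lt0n card_box_gt0. Qed.

Let nu_ge0 : 0 <= nu. Proof. by rewrite invr_ge0. Qed.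

Let c0_sqr : c0%:C * c0%:C = nu%:C.
Proof. by rewrite -rmorphM /= -expr2 sqr_sqrtr. Qed.

Lemma average_const (L : hilbert R) (x : L) : \sum_(m in box) nu%:C *: x = x.
Proof.
rewrite sumr_const -scaler_nat scalerA -[#|_|%:R](rmorph_nat (real_complex R)).
by rewrite -rmorphM /= mulfV// scale1r.
Qed.

Definition rate (i : 'I_d) : R :=
  (B i)%:R^-1 + delta * (\sum_(j < d | (j < i)%N) ((B j).-1)%:R) / 2.

Lemma rate_ge0 i : 0 <= rate i.
Proof.
by rewrite addr_ge0 ?invr_ge0// divr_ge0// mulr_ge0// sumr_ge0.
Qed.

Lemma average_le (L : hilbert R) (F : index -> L) i (a : R) : 0 <= a ->
  (forall m, m \in box -> hnorm (F m) <= cost B delta i m * a) ->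
  hnorm (\sum_(m in box) nu%:C *: F m) <= rate i * a.
Proof.
move=> a0 le; apply: le_trans (hnorm_sum _ _ _) _.
apply: (@le_trans _ _ (\sum_(m in box) nu * (cost B delta i m * a))).
  apply: ler_sum => m mb; rewrite hnormZ ger0_norm ?ler0c//=.
  by rewrite ler_wpM2l// le.
rewrite -mulr_sumr -mulr_suml mulrA ler_wpM2r// mulrC.
rewrite ler_pdivrMr; last by rewrite ltr0n card_box_gt0.
by rewrite mulrC; exact: box_cost.
Qed.

Lemma imono_bump_le i m x : m \in box ->
  hnorm (U i (imono m x) - (if ((m i).+1 < B i)%N
     then expi (beta Theta (ipos m) (ev i)) *: imono (ibump i m) x else 0))
  <= cost B delta i m * hnorm x.
Proof.
move=> mb; rewrite /cost; case: ifP => lt; last first.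
  by rewrite subr0 mul1r (unitary_hnorm _ (uU i)) (unitary_hnorm _ (imono_unitary m)).
by rewrite /imono ibump_nval//; exact: mono_comm.
Qed.

Local Notation V := (@tshift R d Theta H).

Definition cocycle_embed : H -> l2 J H :=
  \sum_(m in box) c0%:C *: (l2_pt (ipos m) \o adj (imono m)).

Definition cocycle_embed_adj : l2 J H -> H :=
  \sum_(m in box) c0%:C *: (imono m \o (fun y => l2_fun y (ipos m))).

Lemma cocycle_embed_bop : bop cocycle_embed.
Proof.
apply: bop_sum => m; apply: bopZ; apply: bop_comp; first exact: l2_pt_bop.
exact: bop_adj.
Qed.

Lemma cocycle_embed_adj_bop : bop cocycle_embed_adj.
Proof.
apply: bop_sum => m; apply: bopZ; apply: bop_comp; last exact: coord_bop.
exact/unitary_bop/imono_unitary.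
Qed.

Lemma cocycle_embed_adjp : adjp cocycle_embed cocycle_embed_adj.
Proof.
apply: adjp_sum => m; apply: adjp_scaler; apply: adjp_comp.
  by move=> x y; rewrite inner_pt.
exact/adjp_sym/unitary_adjp/imono_unitary.
Qed.

Lemma cocycle_embedE x n : l2_fun (cocycle_embed x) n =
  \sum_(m in box) (if n == ipos m then c0%:C *: adj (imono m) x else 0).
Proof.
rewrite /cocycle_embed fun_sumE l2_sum; apply: eq_bigr => m _.
rewrite -[LHS]/(c0%:C *: l2_fun (l2_pt (ipos m) (adj (imono m) x)) n) l2_ptE.
by case: eqP => // _; rewrite scaler0.
Qed.

Lemma cocycle_embed_adjE y : cocycle_embed_adj y =
  \sum_(m in box) c0%:C *: imono m (l2_fun y (ipos m)).
Proof. by rewrite /cocycle_embed_adj fun_sumE. Qed.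

Let imono_lin m : linear (imono m) := (unitary_bop (imono_unitary m)).1.

Lemma cocycle_embedK : cancel cocycle_embed cocycle_embed_adj.
Proof.
move=> x; rewrite cocycle_embed_adjE -[RHS]average_const; apply: eq_bigr => m mb.
rewrite cocycle_embedE (bigD1 m)//= eqxx big1 ?addr0 => [|m' /andP[_ mm]]; last first.
  by rewrite (inj_eq ipos_inj) eq_sym (negbTE mm).
by rewrite (linZ (imono_lin m)) scalerA c0_sqr unitary_Kadj//; exact: imono_unitary.
Qed.

Lemma cocycle_embed_shift i x : cocycle_embed_adj (V i (cocycle_embed x)) = \sum_(m in box) nu%:C *:
  (if ((m i).+1 < B i)%N
   then expi (beta Theta (ipos m) (ev i)) *: imono (ibump i m) (adj (imono m) x)
   else 0).
Proof.
rewrite cocycle_embed_adjE.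
transitivity (\sum_(m' in box) \sum_(m in box) (if ipos m' == ipos m + ev i then
    nu%:C *: (expi (beta Theta (ipos m) (ev i)) *: imono m' (adj (imono m) x)) else 0)).
  apply: eq_bigr => m' _; rewrite tshiftE cocycle_embedE (linZ (imono_lin m')).
  rewrite (lin_sum (imono_lin m')) !scaler_sumr; apply: eq_bigr => m _.
  rewrite -(subr_eq (ipos m')); case: eqP => [->|_].
    by rewrite (linZ (imono_lin m')) !scalerA -c0_sqr; congr (_ *: _); ring.
  by rewrite (lin0 (imono_lin m')) !scaler0.
rewrite exchange_big /=; apply: eq_bigr => m mb; case: ifP => lt.
  rewrite (bigD1 (ibump i m)) ?ibump_box//= ipos_ibump// eqxx big1 ?addr0// => m' /andP[_ ne].
  by rewrite -ipos_ibump// (inj_eq ipos_inj) (negbTE ne).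
(* On the far face the shifted position is not that of any point of the box. *)
rewrite scaler0; apply: big1 => m' mb'; case: eqP => // e.
have := pcong_bump i mb mb'; rewrite lt /= -e.
by have := pcong_eq m' m'; rewrite eqxx => ->.
Qed.

(** Writing [x] as U^m y with y = (U^m)^* x, the [m]-th term of the average compares U_i U^m y with
    the phased U^(m + e_i) y, or with 0 on the far face, and y has the norm of [x]. *)
Lemma cocycle_embed_close i x :
  hnorm (U i x - cocycle_embed_adj (V i (cocycle_embed x))) <= rate i * hnorm x.
Proof.
rewrite cocycle_embed_shift -[X in X - _](average_const (U i x)) -sumrB.
under eq_bigr do rewrite -scalerBr.
apply: average_le; first exact: hnorm_ge0.
move=> m mb; have := imono_bump_le i (adj (imono m) x) mb.
by rewrite unitary_Kadj ?unitary_adj_hnorm//; exact: imono_unitary.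
Qed.

Local Notation G := (l2 index H).
Local Notation E := (@fourier R d p H).
Local Notation E' := (@fourier_adj R d p H).

(** With this phase, the step from m to m + e_i seen at position n carries beta(n - e_i - m, e_i).
    Adding beta(m, e_i), from moving U_i past U^m, gives beta(n - e_i, e_i), the twist of
    [tshift]. *)
Definition fourier_block (m : index) (r : J) (h : H) : G :=
  expi (- beta Theta r (ipos m)) *: E (r + ipos m) (imono m h).

Definition fourier_blockadj (m : index) (r : J) (g : G) : H :=
  expi (beta Theta r (ipos m)) *: adj (imono m) (E' (r + ipos m) g).

Definition fourier_embed : l2 J H -> l2 J G :=
  \sum_(m in box) c0%:C *: wcomp (fun r => r + ipos m) (fourier_block m).

Definition fourier_embed_adj : l2 J G -> l2 J H :=
  \sum_(m in box) c0%:C *: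
    wcomp (fun n => n - ipos m) (fun n => fourier_blockadj m (n - ipos m)).

Let aK (m : index) : cancel (fun r : J => r + ipos m) (fun n => n - ipos m).
Proof. by move=> r; rewrite addrK. Qed.

Let sK (m : index) : cancel (fun n : J => n - ipos m) (fun r => r + ipos m).
Proof. by move=> r; rewrite subrK. Qed.

Let fourier_block_le m r h : hnorm (fourier_block m r h) <= 1 * hnorm h.
Proof.
by rewrite mul1r hnorm_expiZ hnorm_fourier (unitary_hnorm _ (imono_unitary m)).
Qed.

Let fourier_blockadj_le m r g : hnorm (fourier_blockadj m r g) <= 1 * hnorm g.
Proof.
rewrite mul1r hnorm_expiZ (unitary_adj_hnorm _ (imono_unitary m)).
exact: hnorm_fourier_adj.
Qed.

Let fourier_block_lin m r : linear (fourier_block m r).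
Proof.
move=> a x y; rewrite /fourier_block imono_lin (@fourier_bop R d p H _).1 scalerDr !scalerA.
by rewrite [a * _]mulrC.
Qed.

Let fourier_block_adjp m r : adjp (fourier_block m r) (fourier_blockadj m r).
Proof.
move=> x y; rewrite /fourier_block /fourier_blockadj innerZl innerZr fourier_adjp.
by rewrite (unitary_adjp (imono_unitary m)) expiN.
Qed.

Let fourier_blockadj_lin m r : linear (fourier_blockadj m r).
Proof. exact: (adjp_lin (fourier_block_lin m r) (adjp_sym (fourier_block_adjp m r))). Qed.

Lemma fourier_embed_bop : bop fourier_embed.
Proof.
apply: bop_sum => m; apply: bopZ.
exact: (wcomp_bop (aK m) (sK m) ler01 (fourier_block_le m) (fourier_block_lin m)).
Qed.

Lemma fourier_embed_adj_bop : bop fourier_embed_adj.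
Proof.
apply: bop_sum => m; apply: bopZ.
by apply: (wcomp_bop (sK m) (aK m) ler01).
Qed.

Lemma fourier_embed_adjp : adjp fourier_embed fourier_embed_adj.
Proof.
apply: adjp_sum => m; apply: adjp_scaler.
by apply: (wcomp_adj (aK m) (sK m) ler01).
Qed.

Lemma fourier_embedE x r : l2_fun (fourier_embed x) r =
  \sum_(m in box) c0%:C *: fourier_block m r (l2_fun x (r + ipos m)).
Proof.
rewrite /fourier_embed fun_sumE l2_sum; apply: eq_bigr => m _.
rewrite -(wcompE (aK m) (sK m) ler01 (fourier_block_le m)).
by [].
Qed.

Lemma fourier_embed_adjE y n : l2_fun (fourier_embed_adj y) n = \sum_(m in box) c0%:C *:
  (expi (beta Theta (n - ipos m) (ipos m)) *:
     adj (imono m) (E' n (l2_fun y (n - ipos m)))).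
Proof.
rewrite /fourier_embed_adj fun_sumE l2_sum; apply: eq_bigr => m _.
rewrite -[X in E' X _](subrK (ipos m)) -/(fourier_blockadj m _ _).
by rewrite -(wcompE (sK m) (aK m) ler01 (B := fun n => fourier_blockadj m (n - ipos m))).
Qed.

(** One computation with two uses: [T = id], [e = 0] shows that the embedding is isometric, and [T]
    a component of the direct sum, [e = ev i], gives the compression. Character orthogonality leaves
    only the congruent pairs. *)
Lemma fourier_embed_amp (T : G -> G) (T' : H -> H) (e : J) x n : bop T ->
  (forall k h, T (E k h) = E (k + e) (T' h)) ->
  l2_fun (fourier_embed_adj (amp T (fourier_embed x))) n = \sum_(m in box) \sum_(m' in box)
    (if pcong (ipos m') (ipos m + e) then
      nu%:C *: (expi (beta Theta (n - ipos m') (ipos m' - ipos m)) *: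
        adj (imono m') (T' (imono m (l2_fun x (n - ipos m' + ipos m)))))
     else 0).
Proof.
move=> bT TE; rewrite fourier_embed_adjE exchange_big /=; apply: eq_bigr => m' _.
have al : linear (adj (imono m')) := (bop_adj _).1.
have el : linear (E' n) := (@fourier_adj_bop R d p H n).1.
rewrite ampE// fourier_embedE (lin_sum bT.1) (lin_sum el) (lin_sum al) !scaler_sumr.
apply: eq_bigr => m _; rewrite (linZ bT.1) /fourier_block (linZ bT.1) TE.
rewrite !(linZ el) !(linZ al) fourier_ortho.
have -> : [forall j, (p.+1 %| (n - ipos m' + ipos m + e - n)%R 0%R j)%Z]
    = pcong (ipos m') (ipos m + e).
  rewrite /pcong (_ : n - ipos m' + ipos m + e - n = ipos m + e - ipos m')//.
  by apply/rowP => j; rewrite !mxE; ring.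
case: ifP => _; last by rewrite (lin0 al) !scaler0.
by rewrite !scalerA; congr (_ *: _); rewrite -c0_sqr betaDr betaNr expiD; ring.
Qed.

Lemma fourier_embedK : cancel fourier_embed fourier_embed_adj.
Proof.
move=> x; apply: l2_ext => n.
have idE y : amp id y = y :> l2 J G.
  by apply: l2_ext => r; rewrite ampE//; exact: bop_id.
rewrite -[in LHS](idE (fourier_embed x)) (@fourier_embed_amp id id 0) => [||k h].
- rewrite -[RHS]average_const; apply: eq_bigr => m mb; rewrite addr0.
  rewrite (bigD1 m)//= pcong_eq eqxx big1 ?addr0 => [|m' /andP[_ mm]].
    rewrite subrr subrK -[X in beta _ _ X](subrr (0 : J)) betaDr betaNr subrr.
    by rewrite expi0 scale1r unitary_adjK//; exact: imono_unitary.
  by rewrite pcong_eq (negbTE mm).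
- exact: bop_id.
- by rewrite addr0.
Qed.

Lemma fourier_embed_close i (x : l2 J H) :
  hnorm (V i x - fourier_embed_adj (amp (dsum (@torus_pt R d p) U i) (fourier_embed x)))
  <= rate i * hnorm x.
Proof.
pose s (n : J) := n - ev i; pose t (n : J) := n + ev i.
have st : cancel s t by move=> n; rewrite /s /t subrK.
have ts : cancel t s by move=> n; rewrite /s /t addrK.
(* Coordinate [n] of the error depends on [x] only through its value at [n - ev i]: the surviving
   pairs have m' = m + e_i, and then n - m' + m = n - e_i. *)
apply: (l2_dom st ts (rate_ge0 i)) => n; rewrite /s.
have uD : unitary_tuple (dsum (@torus_pt R d p) U).
  exact: (dsum_unitary (@torus_pt_norm R d p) uU).
rewrite -[l2_fun _ n]/(l2_fun (V i x) n - l2_fun (fourier_embed_adj _) n).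
rewrite (@fourier_embed_amp _ (U i) (ev i)); first last.
- by move=> k h; exact: dsum_fourier.
- exact: unitary_bop.
rewrite tshiftE; set h := l2_fun x (n - ev i).
rewrite -(average_const (expi _ *: h)) -sumrB.
rewrite (eq_bigr (fun m : index => nu%:C *: (expi (beta Theta (n - ev i) (ev i)) *: h
  - (if ((m i).+1 < B i)%N then expi (beta Theta (n - ev i - ipos m) (ev i)) *:
       adj (imono (ibump i m)) (U i (imono m h)) else 0)))) => [|m mb].
  apply: average_le; first exact: hnorm_ge0.
  move=> m mb; have := imono_bump_le i h mb; rewrite /cost; case: ifP => lt.
    set b := beta Theta (ipos m) (ev i) => le.
    have ub := imono_unitary (ibump i m).
    (* Factoring out a phase and the adjoint of the bumped monomial, both isometric, leaves exactly
       the commutation error of [imono_bump_le]. *)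
    have -> : expi (beta Theta (n - ev i) (ev i)) *: h
      - expi (beta Theta (n - ev i - ipos m) (ev i)) *:
          adj (imono (ibump i m)) (U i (imono m h))
      = (- expi (beta Theta (n - ev i - ipos m) (ev i))) *: adj (imono (ibump i m))
          (U i (imono m h) - expi b *: imono (ibump i m) h).
      have al := (bop_adj (imono (ibump i m))).1.
      rewrite (linB al) (linZ al) (unitary_adjK ub) scalerBr scalerA !scaleNr mulNr scaleNr opprK.
      rewrite addrC -expiD; congr (_ + expi _ *: _).
      by rewrite (betaDl _ (n - ev i) (- ipos m)) betaNl subrK.
    by rewrite scaleNr hnormN hnorm_expiZ (unitary_adj_hnorm _ ub).
  by move=> _; rewrite subr0 hnorm_expiZ mul1r.
rewrite scalerBr; congr (_ - _); case: ifP => lt.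
  rewrite (bigD1 (ibump i m)) ?ibump_box//= pcong_bump ?ibump_box// lt eqxx /=.
  rewrite big1 ?addr0 => [|m' /andP[mb' ne]]; last first.
    by rewrite pcong_bump// (negbTE ne) andbF.
  rewrite ipos_ibump// (_ : ipos m + ev i - ipos m = ev i); last by rewrite addrC addKr.
  have -> : n - (ipos m + ev i) = n - ev i - ipos m by rewrite opprD addrA addrAC.
  by rewrite subrK.
by rewrite scaler0 big1// => m' mb'; rewrite pcong_bump// lt.
Qed.

End Dilations.

(** With s = sqrt(delta), a direction other than the last costs at most [b], which is below s + (d -
    2) s / 2; the last costs at most [a], which is below s / 2 + (d - 1) s / 2. Both bounds equal d
    s / 2 <= (d - 1) s. For d = 2 the last inequality is an equality, so strictness must come from
    the strict bounds on 1/B_i. *)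
Lemma box_exists (R : realType) (d : nat) (delta : R) : (2 <= d)%N ->
  0 < delta < 1 -> exists (p : nat) (B : 'I_d -> nat) (C : R),
  [/\ forall j, (0 < B j)%N, forall j, (B j <= p)%N,
      forall i, rate delta B i <= C, 0 <= C & C < (d%:R - 1) * Num.sqrt delta].
Proof.
move=> d2 /andP[delta0 _]; set s := Num.sqrt delta.
have s0 : 0 < s by rewrite sqrtr_gt0.
have ss : delta = s * s by rewrite -expr2 sqr_sqrtr// ltW.
have d2R : 2 <= d%:R :> R by rewrite ler_nat.
have size (x : R) : 0 < x -> exists2 n : nat, (n%:R <= x^-1) & (n.+1%:R^-1 < x).
  move=> x0; have xi : 0 <= x^-1 by rewrite invr_ge0 ltW.
  have /andP[le lt] := truncn_itv xi; exists (Num.truncn x^-1) => //.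
  by rewrite -[ltRHS]invrK ltf_pV2// posrE ?invr_gt0.
have [n nle nlt] := size s s0.
(* The last direction already pays (d - 1) s / 2 for commutators, so its boundary term must stay
   below s / 2. *)
have [k _ klt] : exists2 k : nat, k%:R <= (s / 2)^-1 & k.+1%:R^-1 < s / 2.
  by apply: size; rewrite divr_gt0.
pose B (j : 'I_d) := if j.+1 == d then k.+1 else n.+1.
pose a := k.+1%:R^-1 + (d%:R - 1) * s / 2; pose b := n.+1%:R^-1 + (d%:R - 2) * s / 2.
have ns : n%:R * delta <= s.
  by rewrite ss mulrA ler_piMl ?(ltW s0)// -ler_pdivlMr// div1r.
have a0 : 0 <= a.
  by rewrite addr_ge0 ?invr_ge0// divr_ge0// mulr_ge0 ?(ltW s0)//; lra.
exists (maxn k.+1 n.+1), B, (Num.max a b); split.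
- by move=> j; rewrite /B; case: ifP.
- by move=> j; rewrite /B; case: ifP => _; rewrite leq_max leqnn ?orbT.
- move=> i; rewrite /rate.
  (* Every j < i is different from the last index, so the long side never occurs in this sum. *)
  have -> : \sum_(j < d | (j < i)%N) (B j).-1%:R = i%:R * n%:R :> R.
    rewrite (eq_bigr (fun=> n%:R)) => [|j ji].
      rewrite -(big_ord_widen d (fun=> n%:R : R) (ltnW (ltn_ord i))).
      by rewrite sumr_const card_ord mulr_natl.
    by rewrite /B ltn_eqF// (leq_ltn_trans ji).
  have ins : delta * (i%:R * n%:R) <= i%:R * s.
    by rewrite mulrCA ler_wpM2l// mulrC.
  rewrite le_max /B; case: ifPn => [/eqP id|id]; apply/orP; [left|right].
    have e : i%:R = d%:R - 1 :> R by rewrite -[in RHS]id -natr1 addrK.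
    rewrite /a -e; apply: lerD => //.
    by rewrite ler_wpM2r ?invr_ge0.
  have : i%:R <= d%:R - 2 :> R.
    rewrite lerBrDr -natrD ler_nat addn2 ltn_neqAle id /=; exact: ltn_ord.
  move=> id2; rewrite /b; apply: lerD; first exact: lexx.
  rewrite ler_wpM2r ?invr_ge0//; apply: le_trans ins _.
  by rewrite ler_wpM2r// ltW.
- by rewrite le_max a0.
- have ds : 0 <= (d%:R - 2) * s by rewrite mulr_ge0 ?(ltW s0)// subr_ge0.
  rewrite gt_max /a /b; move: klt nlt ds.
  move: (k.+1%:R^-1) (n.+1%:R^-1) (d%:R : R) => u v D ul vl Ds.
  by clear -ul vl Ds; apply/andP; split; lra.
Qed.

Theorem theorem4p3 (R : realType) (d : nat) (hd : (2 <= d)%N)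
    (Theta : 'M[R]_d) (hTheta : Theta^T = - Theta)
    (delta : R) (hdelta : 0 < delta < 1)
    (H : hilbert R) (hH : separable H)
    (U : 'I_d -> H -> H) (hU : unitary_tuple U)
    (hUdelta : forall i j : 'I_d,
       (opnorm (U i \o U j - expi (Theta j i) *: (U j \o U i)) <= delta%:E)%E) :
  exists (HV HU' : hilbert R) (V : 'I_d -> HV -> HV) (U' : 'I_d -> HU' -> HU'),
    [/\ separable HV, separable HU', unitary_tuple V & unitary_tuple U'] /\
    [/\ theta_commuting Theta V,
        exists (Lambda : set ('I_d -> complex R)) (K : hilbert R)
               (W : 'I_d -> K -> K),
          [/\ Lambda `<=` @torus R d, countable Lambda,
              is_direct_sum (fun l : Lambda => scale_tuple (\val l) U) W
            & cstar_equiv U' W],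
        (drD U V < ((d%:R - 1) * Num.sqrt delta)%:E)%E
      & (drD V U' < ((d%:R - 1) * Num.sqrt delta)%:E)%E].
Proof.
have [p [B [C [B0 Bp rC C0 Clt]]]] := box_exists hd hdelta.
have delta0 : 0 <= delta by case/andP: hdelta => /ltW.
have uV := tshift_unitary Theta H.
have uD := dsum_unitary (@torus_pt_norm R d p) hU.
exists (l2 'rV[int]_d H), (l2 {ffun 'I_d -> 'I_p.+1} H), (@tshift R d Theta H),
  (dsum (@torus_pt R d p) U); split.
  by split => //; exact: l2_separable.
split.
(* The direct sum itself is taken as [U'], so the required equivalence below is reflexivity. *)
- exact: tshift_commuting.
- exists (range (@torus_pt R d p)), (l2 {ffun 'I_d -> 'I_p.+1} H),
    (dsum (@torus_pt R d p) U); split.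
  + exact: range_torus (@torus_pt_norm R d p).
  + exact: range_countable.
  + exact: dsum_is_direct_sum (@torus_pt_inj R d p) (@torus_pt_norm R d p) hU.
  + exact: cstar_equiv_refl.
(* The single constant [C] bounds the rates of all directions, and being strictly below the target
   it yields the strict inequality. *)
- apply: le_lt_trans (_ : (C%:E < _)%E); last by rewrite lte_fin.
  have ucpW := compress_ucp uV
    (cocycle_embed_bop p U B) (cocycle_embed_adj_bop p B hU)
    (cocycle_embed_adjp p B hU)
    (cocycle_embedK hU B0 Bp).
  apply: (drD_le hU ucpW C0) => i x.
  apply: le_trans (cocycle_embed_close hU delta0 hUdelta B0 Bp i x) _.
  by rewrite ler_wpM2r ?hnorm_ge0.
- apply: le_lt_trans (_ : (C%:E < _)%E); last by rewrite lte_fin.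
  have ucpW := compress_amp_ucp uD
    (fourier_embed_bop p Theta B hU)
    (fourier_embed_adj_bop p Theta B hU)
    (fourier_embed_adjp Theta B hU) (fourier_embedK Theta hU B0 Bp).
  apply: (drD_le uV ucpW C0) => i x.
  apply: le_trans (fourier_embed_close hU delta0 hUdelta B0 Bp i x) _.
  by rewrite ler_wpM2r ?hnorm_ge0.
Qed.
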